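(* Let $G$ be an $n\times n$ grid with $n$ even. Every non-partitive initial configuration of $k\ge3$ robots on distinct nodes of $G$ in which no corner of the minimum enclosing square is occupied is gatherable despite at most one crash fault.
   Context: Model. The grid is the anonymous grid graph. A configuration is $f:V(G)\to\{0,1,2\}$ ($0$ empty, $1$ singleton, $2$ multiplicity = at least two robots). Robots are anonymous, identical, oblivious, cannot communicate, share no coordinate system, orientation or chirality, run the same deterministic algorithm in Look–Compute–Move cycles (snapshot of the whole configuration with weak multiplicity detection; deterministic decision to stay or move to an adjacent node; instantaneous move), fully asynchronously (finite but unbounded adversarial delays; every non-crashed robot activated infinitely often; moves may use outdated snapshots). At most one robot may crash at an adversarial time: it stops forever, stays visible, indistinguishable. Gatherable despite at most one crash fault: some such algorithm guarantees in every execution with at most one crash that after finite time all non-crashed robots are on one node and remain there. Partitive: some automorphism $\varphi$ of $(G,f)$ (graph automorphism with $f\circ\varphi=f$) of order $p>1$ has all orbits of $V(G)$ under $\langle\varphi\rangle$ of size exactly $p$. Minimum enclosing square: the smallest square subgrid with the same geometric center as the grid containing all occupied nodes; its corners are its four corner nodes. *)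

(* Defs.v *)
(* Model of anonymous oblivious robots on an n x n grid,
   fully asynchronous Look-Compute-Move, weak multiplicity detection,
   at most one crash fault. *)
From mathcomp Require Import all_boot.
Set Implicit Arguments. Unset Strict Implicit. Unset Printing Implicit Defensive.

(* nodes of the n x n grid: (row, column) *)
Definition node (n : nat) : finType := ('I_n * 'I_n)%type.

Definition adj (n : nat) (u v : node n) : bool :=
  ((u.1 == v.1 :> nat) && ((u.2.+1 == v.2 :> nat) || (v.2.+1 == u.2 :> nat)))
  || ((u.2 == v.2 :> nat) && ((u.1.+1 == v.1 :> nat) || (v.1.+1 == u.1 :> nat))).

Definition is_aut (n : nat) (s : node n -> node n) : Prop :=
  bijective s /\ forall u v, adj (s u) (s v) = adj u v.

(* a configuration f : V(G) -> {0,1,2}; here nat-valued *)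
Definition configuration (n : nat) := node n -> nat.

(* the configuration induced by robot positions (weak multiplicity detection):
   0 empty, 1 singleton, 2 multiplicity *)
Definition config (n k : nat) (pos : 'I_k -> node n) : configuration n :=
  fun v => minn 2 #|[pred r | pos r == v]|.

Definition partitive (n : nat) (f : configuration n) : Prop :=
  exists (phi : node n -> node n) (p : nat),
    is_aut phi /\ (forall v, f (phi v) = f v) /\ 1 < p /\
    forall v, fingraph.order phi v = p.

(* concentric squares: for n even, the square subgrid with the same center as
   the grid and side 2d occupies rows/columns n/2-d .. n/2+d-1 *)
Definition in_square (n d : nat) (v : node n) : bool :=
  [&& n./2 - d <= v.1, v.1 < n./2 + d, n./2 - d <= v.2 & v.2 < n./2 + d].

Definition encloses (n d : nat) (f : configuration n) : Prop :=
  forall v, f v != 0 -> in_square d v.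

Definition is_mes (n d : nat) (f : configuration n) : Prop :=
  0 < d <= n./2 /\ encloses d f /\ forall d', 0 < d' < d -> ~ encloses d' f.

Definition is_corner (n d : nat) (v : node n) : bool :=
  ((v.1 == n./2 - d :> nat) || (v.1 == n./2 + d - 1 :> nat)) &&
  ((v.2 == n./2 - d :> nat) || (v.2 == n./2 + d - 1 :> nat)).

Definition mes_corners_empty (n : nat) (f : configuration n) : Prop :=
  forall d v, is_mes d f -> is_corner d v -> f v = 0.

(* A deterministic algorithm: given the snapshot (in the robot's local frame)
   and the robot's own local position, returns the local destination. *)
Definition algorithm (n : nat) := configuration n -> node n -> node n.

Definition valid_alg (n : nat) (A : algorithm n) : Prop :=
  forall g u, A g u = u \/ adj u (A g u).

(* Look+Compute of robot r: the adversary chooses the local frame (any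
   automorphism s, mapping local nodes to global nodes) at each activation *)
Definition look (n k : nat) (A : algorithm n) (p : 'I_k -> node n) (r : 'I_k)
    (target : node n) : Prop :=
  exists (s : node n -> node n) (u : node n),
    is_aut s /\ s u = p r /\ target = s (A (fun x => config p (s x)) u).

(* one atomic event of robot r: either Look (robot idle -> pending destination
   computed from the current snapshot) or Move (pending destination executed,
   instantaneously) *)
Definition step (n k : nat) (A : algorithm n)
    (p q : 'I_k -> node n) (pp pq : 'I_k -> option (node n)) (r : 'I_k) : Prop :=
  (forall r', r' != r -> pq r' = pp r') /\
  ( (pp r = None /\ (forall r', q r' = p r') /\
       exists tgt, look A p r tgt /\ pq r = Some tgt)
  \/ (exists v, pp r = Some v /\ pq r = None /\
       forall r', q r' = if r' == r then v else p r') ).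

Record execution (n k : nat) := Exec {
  epos : nat -> 'I_k -> node n;
  epend : nat -> 'I_k -> option (node n);
  eact : nat -> 'I_k;
  ecrash : option ('I_k * nat)
}.

Definition non_crashed (n k : nat) (e : execution n k) (r : 'I_k) : Prop :=
  forall c tc, ecrash e = Some (c, tc) -> r != c.

Definition is_execution (n k : nat) (A : algorithm n) (pos0 : 'I_k -> node n)
    (e : execution n k) : Prop :=
  (forall r, epos e 0 r = pos0 r) /\ (forall r, epend e 0 r = None) /\
  (forall t, step A (epos e t) (epos e t.+1) (epend e t) (epend e t.+1) (eact e t)) /\
  (forall c tc, ecrash e = Some (c, tc) -> forall t, tc <= t -> eact e t != c) /\
  (forall r, non_crashed e r -> forall t, exists2 t', t <= t' & eact e t' = r).

Definition gathered_eventually (n k : nat) (e : execution n k) : Prop :=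
  exists T (v : node n), forall t, T <= t ->
    forall r, non_crashed e r -> epos e t r = v.

Definition gatherable_1crash (n k : nat) (pos0 : 'I_k -> node n) : Prop :=
  exists A : algorithm n, valid_alg A /\
    forall e : execution n k, is_execution A pos0 e -> gathered_eventually e.

(* Main.v *)
(* The rule may depend on the initial configuration and has to be recognised
   only up to the eight symmetries of the grid.  Fix a frame in which the goal is
   the corner (n-1, n-1), and order nodes by their distance to the centre
   (larger coordinate first, then the smaller one).  Once the outermost occupied
   nodes all lie in the quadrant of the goal, every robot may walk to the goal at
   any time: robots in that quadrant move outwards and the others towards it
   without gaining rank, so the goal stays recognisable whatever the delays, the
   crash and the multiplicities.  It remains to reach such a configuration with
   two robots always enabled.

   If the start has no symmetry, its outermost robots are off the diagonals since
   the corners of the enclosing square are empty.  One of them, in the goal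
   quadrant, moves outwards, or another one moves inwards; when three quadrants
   tie, the middle one is the goal and the two other outermost robots wait.

   If the start has a diagonal symmetry, the goal is a corner on the axis, and the
   robots nearest to the corner of the enclosing square on the two adjacent sides
   run along these sides to that corner.  Every step increases a coordinate sum
   that is odd under reflections, which tells the goal from the other corners. *)
Require Import Defs.
From mathcomp Require Import all_boot all_order all_algebra zify.
From Stdlib Require Import FunctionalExtensionality Classical ClassicalEpsilon.
Set Implicit Arguments. Unset Strict Implicit. Unset Printing Implicit Defensive.
Import GRing.Theory Num.Theory.

(** * Strategies *)

Definition upd (n k : nat) (p : 'I_k -> node n) (r : 'I_k) (w : node n) :
  'I_k -> node n := fun r' => if r' == r then w else p r'.

Lemma upd_same n k (p : 'I_k -> node n) r : upd p r (p r) = p.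
Proof.
by apply: functional_extensionality => r'; rewrite /upd; case: eqP => // ->.
Qed.

Lemma is_aut_id n : is_aut (fun v : node n => v).
Proof. by split=> //; exists id. Qed.

Lemma is_aut_comp n (s h : node n -> node n) :
  is_aut s -> is_aut h -> is_aut (fun v => s (h v)).
Proof.
move=> [bs as_] [bh ah]; split; first exact: (bij_comp bs bh).
by move=> u v; rewrite as_ ah.
Qed.

Lemma is_aut_inv n (s : node n -> node n) :
  is_aut s -> exists2 h, is_aut h & cancel s h /\ cancel h s.
Proof.
move=> [[h sK hK] sA]; exists h => //; split; first by exists s.
by move=> u v; rewrite -sA !hK.
Qed.

Lemma config_neq0 n k (p : 'I_k -> node n) v :
  config p v != 0 <-> exists r, p r = v.
Proof.
rewrite /config; split=> [h|[r <-]].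
  have /card_gt0P[r] : 0 < #|[pred r | p r == v]| by lia.
  by rewrite inE => /eqP; exists r.
have : 0 < #|[pred r' | p r' == p r]| by apply/card_gt0P; exists r; rewrite inE.
by lia.
Qed.

Lemma config_aut n k (p : 'I_k -> node n) (s h : node n -> node n) :
  cancel s h -> cancel h s ->
  config (fun r => s (p r)) = fun v => config p (h v).
Proof.
move=> sK hK; apply: functional_extensionality => v; rewrite /config.
congr minn; apply: eq_card => r; rewrite !inE.
by apply/eqP/eqP => [<-|->]; rewrite ?sK ?hK.
Qed.

(** The same algorithm works: the image of an execution under [h] is again an execution, because the
    frames of the adversary absorb [h]. This lets the goal be put in a fixed quadrant. *)
Lemma gatherable_reframe n k (h : node n -> node n) (pos0 : 'I_k -> node n) :
  is_aut h -> gatherable_1crash (fun r => h (pos0 r)) ->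
  gatherable_1crash pos0.
Proof.
move=> hA [A [vA gA]]; exists A; split=> // e [e0 [e1 [e2 [e3 e4]]]].
have [g gaut [hK gK]] := is_aut_inv hA.
pose e' := Exec (fun t r => h (epos e t r))
  (fun t r => omap h (epend e t r)) (eact e) (ecrash e).
have : is_execution A (fun r => h (pos0 r)) e'.
  split; first by move=> r /=; rewrite e0.
  split; first by move=> r /=; rewrite e1.
  split; last by split.
  move=> t /=; have [s1 s2] := e2 t; split; first by move=> r /s1 ->.
  case: s2 => [[pn [pq [tgt [[s [u [sA [su ->]]]] ->]]]]|[v [-> [-> pq]]]].
    left; split; first by rewrite pn.
    split; first by move=> r; rewrite pq.
    exists (h (s (A (fun x => config (epos e t) (s x)) u))); split=> //.
    exists (fun x => h (s x)), u; split; first exact: is_aut_comp.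
    split; first by rewrite su.
    congr (h (s (A _ _))); apply: functional_extensionality => x.
    by rewrite (config_aut _ hK gK) hK.
  right; exists (h v); split=> //; split=> // r; rewrite pq.
  by case: ifP.
move=> /gA[T [v gv]]; exists T, (g v) => t Tt r nr.
by rewrite -(gv t Tt r nr) /= hK.
Qed.

Lemma nonincreasing_stable (u : nat -> nat) :
  (forall t, u t.+1 <= u t) -> exists T, forall t, T <= t -> u t = u T.
Proof.
move=> du; suff : forall b t0, u t0 <= b -> exists T, forall t, T <= t -> u t = u T.
  by move=> /(_ (u 0) 0 (leqnn _)).
have dle s t : s <= t -> u t <= u s.
  by move=> /subnKC <-; elim: (t - s) => [|d IH]; rewrite ?addn0 // addnS (leq_trans (du _)).
elim=> [|b IH] t0 ub.
  by exists t0 => t /dle h; lia.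
case: (classic (exists2 t, t0 <= t & u t < u t0)) => [[t _ ut]|no].
  by apply: (IH t); lia.
exists t0 => t ht; have := dle _ _ ht; case: (ltnP (u t) (u t0)) => [lt|]; last by lia.
by case: no; exists t.
Qed.

Lemma next_activation n k (A : algorithm n) pos0 (e : execution n k) r t :
  is_execution A pos0 e -> non_crashed e r ->
  exists t', [/\ t <= t', eact e t' = r & epend e t' r = epend e t r].
Proof.
move=> [_ [_ [es [_ el]]]] nr.
have ex : exists d, eact e (t + d) == r.
  by have [t' tt' <-] := el r nr t; exists (t' - t); rewrite subnKC.
case: (ex_minnP ex) => d /eqP ad dmin; exists (t + d); split=> //.
  exact: leq_addr.
have : forall i, i <= d -> epend e (t + i) r = epend e t r.
  elim=> [|i IH] id; first by rewrite addn0.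
  have nar : r != eact e (t + i).
    by apply/eqP => ar; have := dmin i; rewrite -ar eqxx => /(_ isT); lia.
  by rewrite addnS (proj1 (es (t + i)) r nar); apply: IH; lia.
by apply.
Qed.

(* [Al] is the rule as seen on a configuration, in the frame where the goal
   has its fixed place; the certificates [c] record why a position is on
   track, and [Mv c] the moves that are compatible with [c]. *)
Lemma gatherable_of_strategy n k (pos0 : 'I_k -> node n) (C : Type)
    (St : C -> ('I_k -> node n) -> Prop)
    (Mv : C -> ('I_k -> node n) -> 'I_k -> node n -> Prop)
    (Al : configuration n -> node n -> node n -> Prop)
    (mu : node n -> nat) (goal : node n) :
  1 < k ->
  (exists c, St c pos0) ->
  (forall f v w, Al f v w -> w = v \/ adj v w) ->
  (forall c p r, St c p -> exists w, Al (config p) (p r) w) ->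
  (forall c p r h v w, St c p -> is_aut h -> h v = p r ->
     Al (fun x => config p (h x)) v w -> Mv c p r (h w)) ->
  (forall c p r w, St c p -> Mv c p r w -> w = p r \/ mu w < mu (p r)) ->
  (forall c p r w, St c p -> Mv c p r w -> w <> p r ->
     exists2 c', St c' (upd p r w) & forall r' w', r' != r ->
       Mv c p r' w' -> w' = p r' \/ Mv c' (upd p r w) r' w') ->
  (forall c p r0, St c p -> (forall r, r != r0 -> Mv c p r (p r)) ->
     forall r, r != r0 -> p r = goal) ->
  gatherable_1crash pos0.
Proof.
move=> k1 st0 Alv Alex coh dec pers fin.
(* A robot picks, by choice, some frame in which the rule applies to its snapshot and carries the
   answer back; it stays if there is none. Hypothesis [coh] makes every choice acceptable. *)
pose D (g : configuration n) (u w : node n) := exists h v w',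
  [/\ is_aut h, h v = u, h w' = w & Al (fun x => g (h x)) v w'].
pose A (g : configuration n) (u : node n) :=
  epsilon (inhabits u) (fun w => D g u w \/ (~ (exists w', D g u w') /\ w = u)).
have AP g u : D g u (A g u) \/ (~ (exists w', D g u w') /\ A g u = u).
  apply: (epsilon_spec (inhabits u)
    (fun w => D g u w \/ (~ (exists w', D g u w') /\ w = u))).
  by case: (classic (exists w', D g u w')) => [[w Dw]|no]; [exists w; left|exists u; right].
exists A; split.
  move=> g u; have [[h [v [w [hA <- <- /Alv[->|avw]]]]]|[_ ->]] := AP g u.
  - by left.
  - by right; rewrite hA.2.
  - by left.
have lookP c p r tgt : St c p -> look A p r tgt -> Mv c p r tgt.
  move=> stc [s [u [sA [su ->]]]].
  have [g gA [sK gK]] := is_aut_inv sA.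
  have [[h [v [w [hA hv <- al]]]]|[no _]] := AP (fun x => config p (s x)) u.
    apply: (coh c p r (fun x => s (h x)) v w) => //; first exact: is_aut_comp.
    by rewrite hv.
  (* On track the default never occurs: the true frame, pulled back by [g], provides a
     destination. *)
  case: no; have [w alw] := Alex c p r stc; exists (g w), g, (p r), w; split=> //.
    by rewrite -su sK.
  have -> : (fun x => config p (s (g x))) = config p.
    by apply: functional_extensionality => x; rewrite gK.
  by [].
move=> e ex; have [e0 [e1 [es [ec el]]]] := ex.
(* An outdated destination stays harmless: it is void or still compatible with the current
   certificate. *)
pose Inv t := exists2 c, St c (epos e t) & forall r w,
  epend e t r = Some w -> w = epos e t r \/ Mv c (epos e t) r w.
have moveE t v : (forall r', epos e t.+1 r' = if r' == eact e t then v else epos e t r') ->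
    epos e t.+1 = upd (epos e t) (eact e t) v.
  by move=> h; apply: functional_extensionality.
have inv t : Inv t.
  elim: t => [|t [c stc pc]].
    case: st0 => c stc; exists c; last by move=> r w; rewrite e1.
    by have -> : epos e 0 = pos0 by apply: functional_extensionality.
  have [sp [[pn [pq [tgt [lk pt]]]]|[v [pv [pn pq]]]]] := es t.
    have pE : epos e t.+1 = epos e t by apply: functional_extensionality.
    exists c; rewrite pE // => r w; case: (eqVneq r (eact e t)) => [->|nr].
      by rewrite pt => -[<-]; right; apply: lookP lk.
    by rewrite sp //; apply: pc.
  rewrite /Inv (moveE t v pq).
  case: (eqVneq v (epos e t (eact e t))) => [vE|vN].
    rewrite vE upd_same; exists c => // r w.
    by case: (eqVneq r (eact e t)) => [->|nr]; [rewrite pn|rewrite sp //; apply: pc].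
  have [vE|mv] := pc _ _ pv; first by rewrite vE eqxx in vN.
  have [|c' stc' pc'] := pers _ _ _ _ stc mv; first by apply/eqP.
  exists c' => // r w.
  case: (eqVneq r (eact e t)) => [->|nr]; first by rewrite pn.
  rewrite sp // => /pc[->|/(pc' r w nr)]; rewrite /upd (negPf nr); first by left.
  by [].
(* Each real move lowers the total potential, so the positions freeze from some time [T0] on. *)
pose Phi t := \sum_r mu (epos e t r).
have PhiD t : (epos e t.+1 = epos e t) \/ Phi t.+1 < Phi t.
  have [sp [[pn [pq [tgt [lk pt]]]]|[v [pv [pn pq]]]]] := es t.
    by left; apply: functional_extensionality.
  rewrite /Phi (moveE t v pq); set r := eact e t.
  case: (inv t) => c stc /(_ _ _ pv)[vE|/(dec _ _ _ _ stc)[vE|lt]].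
  - by left; rewrite vE upd_same.
  - by left; rewrite vE upd_same.
  right; rewrite (bigD1 r) //= [X in _ < X](bigD1 r) //= {1}/upd eqxx.
  rewrite -addSn leq_add // leq_sum // => r' nr'; by rewrite /upd (negPf nr').
have [T0 PhiT] : exists T, forall t, T <= t -> Phi t = Phi T.
  apply: nonincreasing_stable => t; case: (PhiD t); rewrite /Phi; last by lia.
  by move=> ->.
have posT t : T0 <= t -> epos e t = epos e T0.
  move=> /subnKC <-; elim: (t - T0) => [|d IH]; first by rewrite addn0.
  rewrite addnS -IH; case: (PhiD (T0 + d)) => // lt.
  by move: lt; rewrite (PhiT (T0 + d)) ?(PhiT (T0 + d).+1); lia.
case: (inv T0) => c stc _; set p := epos e T0 in posT stc.
(* After the freeze a live robot finishes its pending move, looks, and executes the result; since it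
   does not change place, [Mv] allows it to stay. *)
have stay r : non_crashed e r -> Mv c p r (p r).
  move=> nr.
  have [t2 [Tt2 a2 pn2]] : exists t, [/\ T0 <= t, eact e t = r & epend e t r = None].
    have [t1 [Tt1 a1 p1]] := next_activation T0 ex nr.
    case pE: (epend e t1 r) => [w|]; last by exists t1.
    have [sp [[pn _]|[v [pv [pn pq]]]]] := es t1.
      by rewrite a1 pE in pn.
    have [t2 [Tt2 a2 p2]] := next_activation t1.+1 ex nr.
    exists t2; split=> //; first by lia.
    by rewrite p2 -[in LHS]a1.
  have [sp [[pn [pq [tgt [lk pt]]]]|[v [pv _]]]] := es t2; last by rewrite a2 pn2 in pv.
  rewrite a2 (posT t2 Tt2) in lk pt.
  have mv := lookP _ _ _ _ stc lk.
  have [t3 [Tt3 a3 p3]] := next_activation t2.+1 ex nr.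
  have [sp3 [[pn3 _]|[v [pv [pn3 /(_ r)]]]]] := es t3.
    by rewrite a3 p3 pt in pn3.
  rewrite a3 eqxx posT; last by lia.
  by move: pv; rewrite a3 p3 pt => -[<-] ->.
exists T0, goal => t Tt r nr; rewrite posT //.
(* [fin] tolerates one exceptional robot: the crashed one, or any robot other than [r] if none
   crashes. *)
have [c0 hc] : exists c0, r != c0 /\ forall r', r' != c0 -> non_crashed e r'.
  case ce: (ecrash e) => [[c1 tc]|].
    exists c1; split; first by apply: nr ce.
    by move=> r' hr' c2 tc2; rewrite ce => -[<- _].
  have [c0 hc0] : exists c0 : 'I_k, r != c0.
    case: (eqVneq r (Ordinal k1)) => [->|]; last by exists (Ordinal k1).
    by exists (Ordinal (ltnW k1)).
  by exists c0; split=> // r' _ c2 tc2; rewrite ce.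
by apply: (fin c p c0) => //; [move=> r' /(hc.2)/stay|exact: hc.1].
Qed.

(** * Automorphisms and ranks *)

Definition flip n (b : bool) (a : 'I_n) : 'I_n := if b then rev_ord a else a.

(** An optional transposition followed by optional reflections: the eight symmetries of the
    square. *)
Definition act n (sw fx fy : bool) (v : node n) : node n :=
  (flip fx (if sw then v.2 else v.1), flip fy (if sw then v.1 else v.2)).

Definition dist n (u v : node n) : nat :=
  (u.1 - v.1) + (v.1 - u.1) + (u.2 - v.2) + (v.2 - u.2).

Lemma node_eq n (u v : node n) : u.1 = v.1 :> nat -> u.2 = v.2 :> nat -> u = v.
Proof. by case: u v => [a b] [c d] /= /val_inj-> /val_inj->. Qed.

Lemma adj_dist n (u v : node n) : adj u v = (dist u v == 1).
Proof. by rewrite /adj /dist; apply/idP/idP; lia. Qed.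

Lemma flipK n b : involutive (@flip n b).
Proof. by case: b => a //; rewrite /flip rev_ordK. Qed.

Lemma actK n sw fx fy :
  cancel (@act n sw fx fy) (act sw (if sw then fy else fx) (if sw then fx else fy)).
Proof. by move=> [a b]; case: sw; rewrite /act /= !flipK. Qed.

Lemma dist_act n sw fx fy (u v : node n) :
  dist (act sw fx fy u) (act sw fx fy v) = dist u v.
Proof.
case: u v => [a b] [c d]; rewrite /dist /act /flip.
by case: sw; case: fx; case: fy => /=;
  have := (ltn_ord a, ltn_ord b, ltn_ord c, ltn_ord d) => -[[[? ?] ?] ?]; lia.
Qed.

Lemma is_aut_act n sw fx fy : is_aut (@act n sw fx fy).
Proof.
split; last by move=> u v; rewrite !adj_dist dist_act.
exists (act sw (if sw then fy else fx) (if sw then fx else fy)).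
  exact: actK.
by have := @actK n sw (if sw then fy else fx) (if sw then fx else fy); case: sw.
Qed.

Lemma dist_tri n (u v w : node n) : dist u w <= dist u v + dist v w.
Proof. by rewrite /dist; lia. Qed.

Lemma dist_pred n (u v : node n) m : dist u v = m.+1 ->
  exists2 w, dist u w = 1 & dist w v = m.
Proof.
case: u v => [a b] [c d]; rewrite /dist /= => h.
have := (ltn_ord a, ltn_ord b, ltn_ord c, ltn_ord d) => -[[[a1 b1] c1] d1].
case: (ltngtP a c) => [lt|lt|E].
- have h1 : a.+1 < n by lia.
  by exists (Ordinal h1, b); rewrite /=; lia.
- have h1 : a.-1 < n by lia.
  by exists (Ordinal h1, b); rewrite /=; lia.
case: (ltngtP b d) => [lt|lt|E'].
- have h1 : b.+1 < n by lia.
  by exists (a, Ordinal h1); rewrite /=; lia.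
- have h1 : b.-1 < n by lia.
  by exists (a, Ordinal h1); rewrite /=; lia.
by lia.
Qed.

(** Shortest paths are mapped to paths, so distances do not grow; the inverse gives equality. *)
Lemma aut_dist n (s : node n -> node n) : is_aut s ->
  forall u v, dist (s u) (s v) = dist u v.
Proof.
have le (s' : node n -> node n) : is_aut s' ->
    forall m u v, dist u v = m -> dist (s' u) (s' v) <= m.
  move=> [_ sA]; elim=> [|m IH] u v.
    move=> h; have -> : u = v by apply: node_eq; move: h; rewrite /dist; lia.
    by rewrite /dist; lia.
  move=> /dist_pred[w uw wv]; have := sA u w; rewrite !adj_dist uw eqxx => /eqP su.
  by have := dist_tri (s' u) (s' w) (s' v); have := IH _ _ wv; lia.
move=> sA u v; have [g gA [sK _]] := is_aut_inv sA.
by have := le _ sA _ u v erefl; have := le _ gA _ (s u) (s v) erefl; rewrite !sK; lia.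
Qed.

(** Automorphisms are isometries. Opposite corners, being at maximal distance, go to opposite
    corners, and a node is determined by its distances to the two corners of one side. *)
Lemma is_aut_classify n (s : node n -> node n) : 1 < n -> is_aut s ->
  exists sw fx fy, s =1 act sw fx fy.
Proof.
move=> n1 sA; have dA := aut_dist sA.
have h0 : 0 < n by lia.
have hz : n.-1 < n by lia.
pose o := Ordinal h0; pose z := Ordinal hz.
have := (dA (o, o) (z, z), dA (o, z) (z, o), dA (o, o) (o, z)).
have d1 v := dA v (o, o).
have d2 v := dA v (o, z).
move: d1 d2; case: (s (o, o)) (s (z, z)) (s (o, z)) (s (z, o)) => [x y] [x1 y1] [x2 y2] [x3 y3].
have := (ltn_ord x, ltn_ord y, ltn_ord x1, ltn_ord y1).
have := (ltn_ord x2, ltn_ord y2, ltn_ord x3, ltn_ord y3).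
rewrite /dist /= => -[[[b1 b2] b3] b4] -[[[b5 b6] b7] b8] d1 d2 [[e1 e2] e3].
have hx : x = 0 :> nat \/ x = n.-1 :> nat by clear -e1 b1 b2 b3 b4 b5 b6 b7 b8 n1; lia.
have hy : y = 0 :> nat \/ y = n.-1 :> nat by clear -e1 b1 b2 b3 b4 b5 b6 b7 b8 n1; lia.
have hx2 : x2 = 0 :> nat \/ x2 = n.-1 :> nat by clear -e2 b1 b2 b3 b4 b5 b6 b7 b8 n1; lia.
have hy2 : y2 = 0 :> nat \/ y2 = n.-1 :> nat by clear -e2 b1 b2 b3 b4 b5 b6 b7 b8 n1; lia.
have E0 (i : 'I_n) : i - 0 + (0 - i) = i by rewrite subn0 sub0n addn0.
have E1 (i : 'I_n) : i - n.-1 + (n.-1 - i) = n.-1 - i.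
  by have := ltn_ord i; clear; lia.
(* The image of [(o, o)] tells the reflections; the coordinates are exchanged exactly if the images
   of [(o, o)] and [(o, z)] differ in the first one. *)
exists (x != x2 :> nat), (x != 0 :> nat), (y != 0 :> nat) => v.
have := (d1 v, d2 v); case: (s v) => [a b]; case: v {d1 d2 e1 e2 dA} => [c d] /=.
have := (ltn_ord a, ltn_ord b, ltn_ord c, ltn_ord d) => -[[[ha hb] hc] hd] [h1 h2].
have nz : (n.-1 == 0) = false by clear -n1; lia.
have zn : (0 == n.-1) = false by clear -n1; lia.
rewrite -[X in X = _]addnA -[X in _ = X]addnA !E0 in h1.
rewrite -[X in X = _]addnA -[X in _ = X]addnA !E0 !E1 in h2.
clear - h1 h2 ha hb hc hd e3 hx hy hx2 hy2 n1 nz zn E0 E1.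
case: hx => hx; case: hy => hy; case: hx2 => hx2; case: hy2 => hy2;
  rewrite hx hy hx2 hy2 ?E0 ?E1 in h1 h2 e3 *; clear E0 E1; try (exfalso; lia);
  apply: node_eq; rewrite /act /flip /= ?nz ?zn ?eqxx /=; lia.
Qed.

(* Distance to the centre in one coordinate, for even [n]: both middle lines
   have distance 0. *)
Definition q n (a : 'I_n) : nat := if n./2 <= a then a - n./2 else n./2 - a.+1.
Definition sg n (a : 'I_n) : bool := n./2 <= a.
Definition QT n (v : node n) : bool := sg v.1 && sg v.2.

(** The larger and the smaller [q] read as two digits in base [n], which gives the lexicographic
    order because [q] is below [n]. *)
Definition rank n (v : node n) : nat :=
  maxn (q v.1) (q v.2) * n + minn (q v.1) (q v.2).

(* Outside the quadrant of the goal only a coordinate on the wrong side of the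
   centre may change, so that the rank does not increase there. *)
Definition step n (v w : node n) : bool :=
  [&& QT v || ~~ sg v.1, w.1 == v.1.+1 :> nat & w.2 == v.2 :> nat] ||
  [&& QT v || ~~ sg v.2, w.1 == v.1 :> nat & w.2 == v.2.+1 :> nat].

Definition at_goal n (v : node n) : bool :=
  (v.1.+1 == n :> nat) && (v.2.+1 == n :> nat).

(** A relation and not a function, so that it is invariant under the transposition, which fixes the
    goal. *)
Definition go n (v w : node n) : Prop := step v w \/ (at_goal v /\ w = v).

Lemma q_flip n b (a : 'I_n) : ~~ odd n -> q (flip b a) = q a.
Proof.
move=> en; case: b => //; rewrite /flip /q /=; have := ltn_ord a.
by repeat case: ifP => ? /=; lia.
Qed.

Lemma sg_flip n b (a : 'I_n) : ~~ odd n -> sg (flip b a) = sg a (+) b.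
Proof.
move=> en; case: b; rewrite ?addbF // addbT /flip /sg /=; have := ltn_ord a; lia.
Qed.

Lemma q_lt n (a : 'I_n) : q a < n.
Proof. by rewrite /q; have := ltn_ord a; case: ifP => ?; lia. Qed.

Lemma rank_act n sw fx fy (v : node n) : ~~ odd n ->
  rank (act sw fx fy v) = rank v.
Proof.
move=> en; rewrite /rank /act /= !q_flip //; case: sw => //.
by rewrite maxnC minnC.
Qed.

Lemma rank_aut n h (v : node n) : ~~ odd n -> 1 < n -> is_aut h -> rank (h v) = rank v.
Proof. by move=> en n1 /(is_aut_classify n1)[sw [fx [fy ->]]]; apply: rank_act. Qed.

Lemma rank_lt n (u v : node n) : (rank u < rank v) =
  (maxn (q u.1) (q u.2) < maxn (q v.1) (q v.2)) ||
  ((maxn (q u.1) (q u.2) == maxn (q v.1) (q v.2)) &&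
   (minn (q u.1) (q u.2) < minn (q v.1) (q v.2))).
Proof.
rewrite /rank.
have : minn (q u.1) (q u.2) < n by have := q_lt u.1; lia.
have : minn (q v.1) (q v.2) < n by have := q_lt v.1; lia.
move: (maxn (q u.1) _) (minn (q u.1) _) (maxn (q v.1) _) (minn (q v.1) _) => a b c d hd hb.
by case: (ltngtP a c) => [lt|lt|->] /=; nia.
Qed.

Lemma step_QT n (v w : node n) : step v w -> QT v -> QT w /\ rank v < rank w.
Proof.
rewrite rank_lt /step => hs hQ; rewrite hQ in hs; move: hs hQ; rewrite /QT /sg => hs /andP[h1 h2].
have [k1 k2] : n./2 <= w.1 /\ n./2 <= w.2 by lia.
by rewrite /q h1 h2 k1 k2; split=> //; lia.
Qed.

(** The moving coordinate is on the wrong side: it approaches the centre or crosses between the two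
    middle lines, both at distance 0. *)
Lemma step_out n (v w : node n) : step v w -> ~~ QT v -> rank w <= rank v.
Proof.
rewrite leqNgt rank_lt /step /QT /sg /q; case: v w => [a b] [c d] /=.
move: (nat_of_ord a) (nat_of_ord b) (nat_of_ord c) (nat_of_ord d) => {}a {}b {}c {}d hs hv.
by repeat case: ifP => ?; lia.
Qed.

Lemma step_adj n (v w : node n) : step v w -> adj v w.
Proof. by rewrite /step /adj; lia. Qed.

Lemma step_measure n (v w : node n) : step v w ->
  (n - w.1) + (n - w.2) < (n - v.1) + (n - v.2).
Proof.
case: v w => [a b] [c d]; rewrite /step /QT /sg /=; move: (ltn_ord c) (ltn_ord d).
by move: (nat_of_ord a) (nat_of_ord b) (nat_of_ord c) (nat_of_ord d) => {}a {}b {}c {}d; lia.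
Qed.

Lemma step_neq n (v w : node n) : step v w -> w <> v.
Proof. by move=> h E; move: h; rewrite E /step; lia. Qed.

Lemma step_up n (v : node n) : v.2.+1 < n -> QT v || ~~ sg v.2 ->
  exists2 w, step v w & w.1 = v.1 /\ w.2 = v.2.+1 :> nat.
Proof. by move=> h Q; exists (v.1, Ordinal h); rewrite /step /= ?Q ?eqxx ?orbT. Qed.

Lemma step_right n (v : node n) : v.1.+1 < n -> QT v || ~~ sg v.1 ->
  exists2 w, step v w & w.1 = v.1.+1 :> nat /\ w.2 = v.2.
Proof. by move=> h Q; exists (Ordinal h, v.2); rewrite /step /= ?Q ?eqxx. Qed.

Lemma go_exists n (v : node n) : exists w, go v w.
Proof.
have := (ltn_ord v.1, ltn_ord v.2) => -[h1 h2].
have [Q|nQ] := boolP (QT v).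
  case: (ltnP v.1.+1 n) => [h|h3].
    by have [w hw _] := step_right h (introT orP (or_introl Q)); exists w; left.
  case: (ltnP v.2.+1 n) => [h|h4].
    by have [w hw _] := step_up h (introT orP (or_introl Q)); exists w; left.
  by exists v; right; split=> //; rewrite /at_goal; lia.
have [s1|s1] := boolP (sg v.1).
  have s2 : ~~ sg v.2 by move: nQ; rewrite /QT s1.
  have h : v.2.+1 < n by move: s2; rewrite /sg; lia.
  by have [w hw _] := step_up h (introT orP (or_intror s2)); exists w; left.
have h : v.1.+1 < n by move: s1; rewrite /sg; lia.
by have [w hw _] := step_right h (introT orP (or_intror s1)); exists w; left.
Qed.

(** If both coordinates are on the wrong side, the one farther from the centre moves; its distance
    is positive, so the rank drops. If only one is, it moves, and the rank drops unless it crosses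
    into the goal quadrant. *)
Lemma step_in n (v : node n) : ~~ odd n -> ~~ QT v -> q v.1 != q v.2 ->
  exists2 w, step v w & (rank w < rank v) || (sg v.1 || sg v.2) && QT w.
Proof.
have := (ltn_ord v.1, ltn_ord v.2) => -[h1 h2] en nQ dq.
have [c|c] := boolP (~~ sg v.1 && (sg v.2 || (q v.2 < q v.1))).
  have h : v.1.+1 < n by move: c; rewrite /sg; lia.
  have [|w hw [w1 w2]] := step_right h; first by case/andP: c => -> _; rewrite orbT.
  exists w => //; clear hw; rewrite rank_lt.
  move: c dq nQ w1 (congr1 val w2) h1 h2 h; rewrite /QT /sg /q {w2}.
  case: v w => [a b] [c d] /=.
  move: (nat_of_ord a) (nat_of_ord b) (nat_of_ord c) (nat_of_ord d) => {}a {}b {}c {}d.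
  by move=> + + + ? ? ? ? ?; repeat case: ifP => ?; lia.
have s2 : ~~ sg v.2 by move: c nQ; rewrite /QT; case: (sg v.1); case: (sg v.2).
have h : v.2.+1 < n by move: s2; rewrite /sg; lia.
have [|w hw [w1 w2]] := step_up h; first by rewrite s2 orbT.
exists w => //; clear hw; rewrite rank_lt.
move: s2 c dq nQ (congr1 val w1) w2 h1 h2 h; rewrite /QT /sg /q {w1}.
case: v w => [a b] [c d] /=.
move: (nat_of_ord a) (nat_of_ord b) (nat_of_ord c) (nat_of_ord d) => {}a {}b {}c {}d.
by move=> + + + + ? ? ? ? ?; repeat case: ifP => ?; lia.
Qed.

Lemma at_goal_rank n (u v : node n) : ~~ odd n -> at_goal v -> rank u <= rank v.
Proof.
move=> en; rewrite /at_goal leqNgt rank_lt /q; case: u v => [a b] [c d] /=.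
move: (ltn_ord a) (ltn_ord b).
move: (nat_of_ord a) (nat_of_ord b) (nat_of_ord c) (nat_of_ord d) => {}a {}b {}c {}d ? ? ?.
by repeat case: ifP => ?; lia.
Qed.

Lemma at_goal_q n (v : node n) : at_goal v -> q v.1 = q v.2.
Proof. by rewrite /at_goal => g; have -> : v.1 = v.2 by apply: ord_inj; lia. Qed.

Lemma rank_q n (u v : node n) : rank u = rank v ->
  maxn (q u.1) (q u.2) = maxn (q v.1) (q v.2) /\
  minn (q u.1) (q u.2) = minn (q v.1) (q v.2).
Proof.
by move=> h; have := rank_lt u v; have := rank_lt v u; rewrite h ltnn; lia.
Qed.

Lemma aut_QT n h (v : node n) : ~~ odd n -> is_aut h -> QT v -> QT (h v) ->
  h =1 act false false false \/ h =1 act true false false.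
Proof.
move=> en hA; have n1 : 1 < n by have := ltn_ord v.1; lia.
have [sw [fx [fy hE]]] := is_aut_classify n1 hA; rewrite hE /QT /act /= !sg_flip //.
move: hE; case: fx; case: fy; case: sw => hE; case: (sg v.1); case: (sg v.2) => //= _ _.
  by right.
by left.
Qed.

Lemma go_act n sw (v w : node n) : go v w -> go (act sw false false v) (act sw false false w).
Proof.
case: sw; rewrite /go /step /at_goal /QT /act /flip /=; last by move=> [h|[h ->]]; [left|right].
move=> [h|[h ->]]; last by right; rewrite andbC.
left; move: h; rewrite /sg; case: v w => [a b] [c d] /=.
by move: (nat_of_ord a) (nat_of_ord b) (nat_of_ord c) (nat_of_ord d) => {}a {}b {}c {}d; lia.
Qed.

Lemma go_aut n h (u v w : node n) : ~~ odd n -> is_aut h ->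
  QT u -> QT (h u) -> go v w -> go (h v) (h w).
Proof. by move=> en hA Qu Qhu; case: (aut_QT en hA Qu Qhu) => hE; rewrite !hE; apply: go_act. Qed.

(** * Dominant quadrants and finite tables *)

(** The goal quadrant is recognised by holding all occupied nodes of maximal rank. A positive
    threshold [th] keeps this stage apart from the mirror tables, whose occupied nodes have rank
    below it. *)
Definition dominant n (th : nat) (f : configuration n) : Prop :=
  exists v0, [/\ f v0 != 0, QT v0, th <= rank v0 &
    forall v, f v != 0 -> ~~ QT v -> rank v < rank v0].

(** The outermost nodes meet three quadrants and the goal lies in the middle one, which may hold
    several; [v1] and [v3] are alone in the neighbouring ones. As [v2] is off the diagonals, its
    rank is not that of the goal. *)
Definition three_tops n (th : nat) (f : configuration n) (v1 v2 v3 : node n) : Prop :=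
  [/\ [/\ f v1 != 0, f v2 != 0 & f v3 != 0],
      [/\ ~~ sg v1.1 && sg v1.2, QT v2 & sg v3.1 && ~~ sg v3.2],
      [/\ rank v1 = rank v2, rank v3 = rank v2, th <= rank v2 & q v2.1 != q v2.2] &
      forall v, f v != 0 ->
        [|| v == v1, v == v3, rank v < rank v2 | QT v && (rank v <= rank v2)]].

(** Certificates must remember which robots wait: [r1] and [r3]. No other robot can share their
    nodes. *)
Definition three_top_robots n k (th : nat) (p : 'I_k -> node n) (r1 r3 : 'I_k) : Prop :=
  exists r2, [/\ [/\ ~~ sg (p r1).1 && sg (p r1).2, QT (p r2) & sg (p r3).1 && ~~ sg (p r3).2],
      [/\ rank (p r1) = rank (p r2), rank (p r3) = rank (p r2), th <= rank (p r2) &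
          q (p r2).1 != q (p r2).2] &
      forall r, [|| r == r1, r == r3, rank (p r) < rank (p r2) |
                    QT (p r) && (rank (p r) <= rank (p r2))]].

Lemma three_top_robots_config n k th (p : 'I_k -> node n) r1 r3 :
  three_top_robots th p r1 r3 ->
  exists v2, three_tops th (config p) (p r1) v2 (p r3).
Proof.
move=> [r2 [hs hr hall]]; exists (p r2); split=> //.
  by split; apply/config_neq0; [exists r1|exists r2|exists r3].
move=> v /config_neq0[r <-]; case/or3P: (hall r) => [/eqP->|/eqP->|h].
- by rewrite eqxx.
- by rewrite eqxx orbT.
- by rewrite h !orbT.
Qed.

Lemma aut_quadrant n h (u v : node n) : ~~ odd n -> 1 < n -> is_aut h ->
  QT (h u) -> QT (h v) -> sg u.1 = sg v.1 /\ sg u.2 = sg v.2.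
Proof.
move=> en n1 hA; have [sw [fx [fy hE]]] := is_aut_classify n1 hA.
rewrite !hE /QT /act /= !sg_flip // {hE}; case: sw; case: fx; case: fy; rewrite ?addbF ?addbT;
by case: (sg u.1); case: (sg u.2); case: (sg v.1); case: (sg v.2).
Qed.

(** If the two goal quadrants differed, the dominating node of each frame would lie outside the goal
    quadrant of the other, and each rank would be strictly below the other. *)
Lemma dominant_dominant n th (f : configuration n) h :
  ~~ odd n -> 1 < n -> is_aut h ->
  dominant th f -> dominant th (fun x => f (h x)) -> exists2 u, QT u & QT (h u).
Proof.
move=> en n1 hA [v0 [f0 Q0 _ m0]] [v1 [f1 Q1 _ m1]].
have [Qh|nQ] := boolP (QT (h v1)); first by exists v1.
have [g gA [hK gK]] := is_aut_inv hA.
exists (g v0); last by rewrite gK.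
apply/negPn/negP => nQ'; have := m0 _ f1 nQ; have := m1 (g v0).
rewrite gK (rank_aut _ en n1 gA) (rank_aut _ en n1 hA) => /(_ f0 nQ'); lia.
Qed.

Lemma three_tops_max n th (f : configuration n) v1 v2 v3 v :
  three_tops th f v1 v2 v3 -> f v != 0 -> rank v <= rank v2.
Proof.
move=> [_ _ [e1 e2 _ _] mx] /mx/or4P[/eqP->|/eqP->|/ltnW|/andP[]] //.
  by rewrite e1.
by rewrite e2.
Qed.

Lemma dominant_three_tops n th (f : configuration n) h v1 v2 v3 :
  ~~ odd n -> 1 < n -> is_aut h ->
  dominant th f -> three_tops th (fun x => f (h x)) v1 v2 v3 -> False.
Proof.
move=> en n1 hA [v0 [f0 Q0 _ m0]] t; have [[f1 f2 f3] [s1 s2 s3] [e1 e2 _ _] mx] := t.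
have [g gA [hK gK]] := is_aut_inv hA.
have le : rank v0 <= rank v2.
  by rewrite -(rank_aut v0 en n1 gA); apply: (three_tops_max t); rewrite gK.
have inQ v : f (h v) != 0 -> rank v = rank v2 -> QT (h v).
  move=> fv rv; apply/negPn/negP => nQ.
  by have := m0 _ fv nQ; rewrite (rank_aut _ en n1 hA) rv ltnNge le.
have Q1 := inQ _ f1 e1.
have Q2 := inQ _ f2 erefl.
have [E _] := aut_quadrant en n1 hA Q1 Q2.
by move: s1 s2; rewrite /QT E; case: (sg v2.1).
Qed.

(** Just one quadrant holds no node of maximal rank, and the goal is opposite to it; so both frames
    agree on the goal and, up to transposition, on the waiting nodes. *)
Lemma three_tops_three_tops n th (f : configuration n) h v1 v2 v3 w1 w2 w3 :
  ~~ odd n -> 1 < n -> is_aut h ->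
  three_tops th f v1 v2 v3 -> three_tops th (fun x => f (h x)) w1 w2 w3 ->
  QT (h w2) /\ forall v, f (h v) != 0 ->
    ((h v == v1) || (h v == v3)) = ((v == w1) || (v == w3)).
Proof.
move=> en n1 hA tv tw; have [[f1 f2 f3] [s1 s2 s3] [e1 e2 _ _] mx] := tv.
have [[g1 g2 g3] [t1 t2 t3] [d1 d2 _ _] my] := tw.
have rh v : rank (h v) = rank v := rank_aut v en n1 hA.
have [g gA [hK gK]] := is_aut_inv hA.
have rg v : rank (g v) = rank v := rank_aut v en n1 gA.
have rE : rank v2 = rank w2.
  apply: anti_leq; rewrite -{1}(rg v2) (three_tops_max tw) ?gK //=.
  by rewrite -rh; apply: (three_tops_max tv).
have top v : f (h v) != 0 -> rank v = rank v2 -> (h v == v1) || (h v == v3) || QT (h v).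
  by move=> /mx; rewrite rh => + E; rewrite E ltnn leqnn;
    case: (_ == v1); case: (_ == v3); case: (QT _).
have nn v : f (h v) != 0 -> rank v = rank v2 -> sg (h v).1 || sg (h v).2.
  move=> fv rv; have := top v fv rv; case/orP => [/orP[/eqP->|/eqP->]|].
  - by case/andP: s1 => _ ->; rewrite orbT.
  - by case/andP: s3 => ->.
  - by case/andP => ->.
have n1' := nn _ g1 (etrans d1 (esym rE)).
have n2' := nn _ g2 (esym rE).
have n3' := nn _ g3 (etrans d2 (esym rE)).
(* In both frames the three top nodes avoid the quadrant opposite to the goal, which leaves no
   reflection in [h]. *)
have QE : forall v, QT (h v) = QT v.
  have [sw [fx [fy hE]]] := is_aut_classify n1 hA.
  move: n1' n2' n3'; rewrite !hE /QT /act /= !sg_flip //.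
  move: t1 t2 t3; rewrite /QT; case: sw hE => hE /=;
  case: (sg w1.1); case: (sg w1.2) => //= _; case: (sg w2.1); case: (sg w2.2) => //= _;
  case: (sg w3.1); case: (sg w3.2) => //= _;
  case: fx hE; case: fy => hE //= _ //= _ //= _ v; rewrite hE /act /flip //=.
  exact: andbC.
split=> [|v fv]; first by rewrite QE.
apply/idP/idP => hv.
  have [rv nQ] : rank v = rank w2 /\ ~~ QT v.
    rewrite -QE -rh; case/orP: hv => /eqP->; split; rewrite -?rE //.
      by rewrite /QT; case/andP: s1 => /negPf-> _.
    by rewrite /QT; case/andP: s3 => _ /negPf->; rewrite andbF.
  by have := my _ fv; rewrite rv ltnn (negPf nQ) !orbF.
have [rv nQ] : rank v = rank v2 /\ ~~ QT v.
  case/orP: hv => /eqP->; split; rewrite ?rE //.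
    by rewrite /QT; case/andP: t1 => /negPf-> _.
  by rewrite /QT; case/andP: t3 => _ /negPf->; rewrite andbF.
by have := top v fv rv; rewrite QE (negPf nQ) orbF.
Qed.

(** Why a position is on track: it is an entry of the table, its goal quadrant dominates, or three
    quadrants tie and the two named robots wait. *)
Inductive cert (I : Type) (k : nat) :=
  Tab of I | Dom | Three of 'I_k & 'I_k.
Arguments Dom {I k}.
Arguments Three {I k}.
Arguments Tab {I k}.

(** Besides two waiting robots and a crashed one, a fourth must be running: hence the condition
    [3 < k] on the stage with three tops. *)
Lemma ord_avoid3 k (a b c : 'I_k) : 3 < k -> exists r, [/\ r != a, r != b & r != c].
Proof.
move=> k3; have /card_gt0P[r] : 0 < #|~: [set a; b; c]|.
  have := cardsC [set a; b; c]; rewrite card_ord.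
  have : #|[set a; b; c]| <= 3 by rewrite setUC cardsU1 cards2; lia.
  by lia.
by rewrite !inE !negb_or => /andP[/andP[h1 h2] h3]; exists r.
Qed.

(** A step inside the goal quadrant raises a rank there, and a step from outside raises none, so
    dominance survives. *)
Lemma dominant_step n k th (p : 'I_k -> node n) r w :
  dominant th (config p) -> step (p r) w -> dominant th (config (upd p r w)).
Proof.
move=> [v0 [/config_neq0[r0 <-] Q0 th0 m0]] st.
have oth r' : r' != r -> upd p r w r' = p r' by rewrite /upd => /negPf->.
have sam : upd p r w r = w by rewrite /upd eqxx.
have occ r' : config p (p r') != 0 by apply/config_neq0; exists r'.
have [E|nr] := eqVneq r0 r.
  rewrite E in Q0 th0 m0 *; have [Qw lt] := step_QT st Q0.
  exists w; split=> //; [by apply/config_neq0; exists r|by lia|].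
  move=> v /config_neq0[r' <-]; have [->|/oth->] := eqVneq r' r; first by rewrite sam Qw.
  by move=> /(m0 _ (occ r')); lia.
exists (p r0); split=> //; first by apply/config_neq0; exists r0; rewrite oth.
move=> v /config_neq0[r' <-]; have [->|/oth->] := eqVneq r' r; last exact: m0 (occ r').
rewrite sam => nQw; have nQ : ~~ QT (p r).
  by apply/negP => /(step_QT st)[Qw _]; rewrite Qw in nQw.
by have := step_out st nQ; have := m0 _ (occ r) nQ; lia.
Qed.

(** The first robot to exceed the common maximal rank does so in the goal quadrant, which becomes
    dominant; until then [r2] has not moved. *)
Lemma three_step n k th (p : 'I_k -> node n) r1 r3 r w :
  three_top_robots th p r1 r3 -> r != r1 -> r != r3 -> step (p r) w ->
  dominant th (config (upd p r w)) \/ three_top_robots th (upd p r w) r1 r3.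
Proof.
move=> [r2 [[s1 s2 s3] [e1 e2 hth hq] mx]] nr1 nr3 st.
have oth r' : r' != r -> upd p r w r' = p r' by rewrite /upd => /negPf->.
have sam : upd p r w r = w by rewrite /upd eqxx.
have mxle r' : rank (p r') <= rank (p r2).
  by case/or4P: (mx r') => [/eqP->|/eqP->|/ltnW|/andP[]] //; rewrite ?e1 ?e2.
have [/andP[Qw lt]|nw] := boolP (QT w && (rank (p r2) < rank w)).
  left; exists w; split=> //; [by apply/config_neq0; exists r|exact: leq_trans hth (ltnW lt)|].
  move=> v /config_neq0[r' <-]; have [->|/oth->] := eqVneq r' r; first by rewrite sam Qw.
  by move=> _; apply: leq_ltn_trans (mxle r') lt.
right; have nr2 : r2 != r.
  by apply/eqP => E; rewrite -E in st; have [Qw lt] := step_QT st s2; rewrite Qw lt in nw.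
have [nr1' nr3'] : r1 != r /\ r3 != r by rewrite ![_ == r]eq_sym.
exists r2; rewrite !oth //; split=> // r'.
have [->|/oth->] := eqVneq r' r; last exact: mx.
rewrite (negPf nr1) (negPf nr3) sam /=.
have [Q|nQ] := boolP (QT (p r)).
  by have [Qw _] := step_QT st Q; move: nw; rewrite Qw /= -leqNgt => ->; rewrite orbT.
have := mx r; rewrite (negPf nr1) (negPf nr3) (negPf nQ) /= orbF.
by move=> lt; rewrite (leq_ltn_trans (step_out st nQ) lt).
Qed.

(** The stages [Dom] and [Three] run by themselves, so a start needs only a table of positions [P]
    with destinations [M]. It must commute with isomorphisms, never be confused with these stages,
    lead on after each move without spoiling other pending moves, and always enable two robots. *)
Lemma gatherable_of_table n k (pos0 : 'I_k -> node n) th (I : Type)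
    (V : I -> Prop) (P : I -> 'I_k -> node n) (M : I -> 'I_k -> node n) :
  ~~ odd n -> 1 < n -> 1 < k ->
  (forall i r, V i -> M i r = P i r \/ step (P i r) (M i r)) ->
  (forall i j h r r', V i -> V j -> is_aut h ->
     (fun x => config (P i) (h x)) = config (P j) ->
     h (P j r') = P i r -> h (M j r') = M i r) ->
  (forall i h, V i -> is_aut h -> ~ dominant th (fun x => config (P i) (h x))) ->
  (forall i h v1 v2 v3, V i -> is_aut h -> 3 < k ->
     ~ three_tops th (fun x => config (P i) (h x)) v1 v2 v3) ->
  (forall i r, V i -> M i r <> P i r ->
     [\/ dominant th (config (upd (P i) r (M i r))),
         (exists2 j, V j /\ upd (P i) r (M i r) = P j &
            forall r', r' != r -> M i r' = P i r' \/ M j r' = M i r') |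
         (3 < k /\ exists r1 r3, three_top_robots th (upd (P i) r (M i r)) r1 r3 /\
            forall r', r' != r -> M i r' <> P i r' -> r' != r1 /\ r' != r3)]) ->
  (forall i r0, V i -> exists2 r, r != r0 & M i r <> P i r) ->
  [\/ exists2 i, V i & pos0 = P i,
      dominant th (config pos0) |
      3 < k /\ exists r1 r3, three_top_robots th pos0 r1 r3] ->
  gatherable_1crash pos0.
Proof.
move=> en n1 k1 Hst Hiso Hub Hu3 Htr Hpr init.
have hz : n.-1 < n by lia.
pose T : node n := (Ordinal hz, Ordinal hz).
have goalT v : at_goal v -> v = T.
  rewrite /at_goal => /andP[/eqP g1 /eqP g2].
  by apply: node_eq; [exact: (congr1 predn g1)|exact: (congr1 predn g2)].
pose St (c : cert I k) p := match c with
  | Tab i => V i /\ p = P i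
  | Dom => dominant th (config p)
  | Three r1 r3 => 3 < k /\ three_top_robots th p r1 r3 end.
pose Mv (c : cert I k) (p : 'I_k -> node n) r w := match c with
  | Tab i => w = M i r
  | Dom => go (p r) w
  | Three r1 r3 => if (r == r1) || (r == r3) then w = p r else go (p r) w end.
pose Al (f : configuration n) v w :=
  [\/ exists i r, [/\ V i, f = config (P i), P i r = v & M i r = w],
      dominant th f /\ go v w |
      3 < k /\ exists v1 v2 v3, three_tops th f v1 v2 v3 /\
        if (v == v1) || (v == v3) then w = v else go v w].
have goE v w : go v w -> w = v \/ step v w by move=> [|[]]; [right|left].
have MvE c p r w : St c p -> Mv c p r w -> w = p r \/ step (p r) w.
  case: c => [i||r1 r3] /=.
  - by move=> [Vi ->] ->; apply: Hst.
  - by move=> _ /goE.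
  - by move=> _; case: ifP => _; [left|move=> /goE].
apply: (@gatherable_of_strategy n k pos0 (cert I k) St Mv Al
  (fun v => (n - v.1) + (n - v.2)) T) => //.
- case: init => [[i Vi ->]|dom|[k3 [r1 [r3 t]]]]; first by exists (Tab i).
    by exists Dom.
  by exists (Three r1 r3).
- move=> f v w.
  have goA : go v w -> w = v \/ adj v w by move=> /goE[|/step_adj]; [left|right].
  case=> [[i [r [Vi _ <- <-]]]|[_ /goA //]|[_ [v1 [v2 [v3 [_]]]]]].
    by case: (Hst i r Vi) => [->|/step_adj]; [left|right].
  by case: ifP => _; [left|].
- move=> c p r; case: c => [i||r1 r1'] /=.
  + by move=> [Vi ->]; exists (M i r); constructor 1; exists i, r.
  + by move=> dom; have [w gw] := go_exists (p r); exists w; constructor 2.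
  + move=> [k3 /three_top_robots_config[v2 t]].
    have [w gw] := go_exists (p r).
    exists (if (p r == p r1) || (p r == p r1') then p r else w); constructor 3; split=> //.
    by exists (p r1), v2, (p r1'); split=> //; case: (_ || _).
(* Coherence: two frames can only see the same stage, and within a stage they give compatible
   moves. *)
- move=> c p r h v w stc hA hv al.
  have [g gA [hK gK]] := is_aut_inv hA.
  have back : (fun x => config p (h (g x))) = config p.
    by apply: functional_extensionality => x; rewrite gK.
  have occ : config p (h v) != 0 by apply/config_neq0; exists r.
  case: c stc => [i||r1 r1'] /=.
  + move=> [Vi pE]; subst p; case: al => [[j [r' [Vj fE vE wE]]]|[dom _]|[k3 [v1 [v2 [v3 [t _]]]]]].
    * by rewrite -wE; apply: (Hiso i j h r r') => //; rewrite vE.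
    * by case: (Hub i h Vi hA dom).
    * by case: (Hu3 i h v1 v2 v3 Vi hA k3 t).
  + move=> dom; case: al => [[j [r' [Vj fE _ _]]]|[dom' gvw]|[k3 [v1 [v2 [v3 [t _]]]]]].
    * case: (Hub j g Vj gA); rewrite -fE; by rewrite back.
    * have [u Qu Qhu] := dominant_dominant en n1 hA dom dom'.
      by rewrite -hv; apply: go_aut Qu Qhu gvw.
    * by case: (dominant_three_tops en n1 hA dom t).
  + move=> [k3 tr]; have [v2' t'] := three_top_robots_config tr.
    case: tr => r2 [[s1 s2 s3] [e1 e2 _ _] mx].
    case: al => [[j [r' [Vj fE _ _]]]|[dom' gvw]|[_ [v1 [v2 [v3 [t]]]]]].
    * by case: (Hu3 j g (p r1) v2' (p r1') Vj gA k3); rewrite -fE back.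
    * by case: (@dominant_three_tops _ th _ g (p r1) v2' (p r1') en n1 gA dom'); rewrite back.
    * have [Qh frz] := three_tops_three_tops en n1 hA t' t.
      have Q2 : QT v2 by case: t => _ [].
      rewrite -frz // hv; have [/eqP E|] /= := boolP (r == r1).
        by rewrite E eqxx /= => ->; rewrite hv E.
      have [/eqP E|] /= := boolP (r == r1').
        by move=> _; rewrite E eqxx orbT => ->; rewrite hv E.
      (* A third robot on a waiting node would have maximal rank outside the goal quadrant. *)
      move=> nr3 nr1; case: ifP => [pe _|_ gvw]; last by rewrite -hv; apply: go_aut Q2 Qh gvw.
      have := mx r; rewrite (negPf nr1) (negPf nr3) /=.
      have [rE nQ] : rank (p r) = rank (p r2) /\ ~~ QT (p r).
        case/orP: pe => /eqP->; rewrite /QT; split=> //.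
          by case/andP: s1 => /negPf->.
        by case/andP: s3 => _ /negPf->; rewrite andbF.
      by rewrite rE ltnn (negPf nQ).
- move=> c p r w stc /(MvE _ _ _ _ stc)[|st]; [by left|right].
  exact: step_measure.
- move=> c p r w stc mv neq.
  have [//|st] := MvE _ _ _ _ stc mv.
  have oth r' : r' != r -> upd p r w r' = p r' by rewrite /upd => /negPf->.
  case: c stc mv => [i||r1 r1'] /=.
  + move=> [Vi pE] wE; subst p w; have [dom|[j [Vj uE] Mj]|[k3 [r1 [r3 [t Mt]]]]] := Htr i r Vi neq.
    * exists Dom => //= r' w' nr' ->; rewrite oth //.
      by case: (Hst i r' Vi) => [|h]; [left|right; left].
    * by exists (Tab j) => //= r' w' nr' ->; case: (Mj r' nr') => <-; [left|right].
    * exists (Three r1 r3) => //= r' w' nr' ->; rewrite oth //.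
      case: (Hst i r' Vi) => [|h]; [by left|right].
      have [|/negPf-> /negPf->] := Mt r' nr'; first exact: step_neq.
      by left.
  + move=> dom _; exists Dom => //=; first exact: dominant_step.
    by move=> r' w' nr' g; right; rewrite oth.
  + move=> [k3 t]; case: ifP => [_ E|/negbT]; first by rewrite E in neq.
    rewrite negb_or => /andP[nr1 nr3] _.
    have [dom|t'] := three_step t nr1 nr3 st.
      exists Dom => //= r' w' nr'; rewrite oth //.
      by case: ifP => _; [left|right].
    by exists (Three r1 r1') => //= r' w' nr'; rewrite oth //; right.
- move=> c p r0; case: c => [i||r1 r1'] /=.
  + by move=> [Vi ->] h; have [r nr neq] := Hpr i r0 Vi; case: neq; rewrite -h.
  + by move=> _ h r /h[/step_neq //|[/goalT]].
  + move=> [k3 [r2 [[s1 s2 s3] [e1 e2 hth hq] mx]]] h.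
    (* This robot rests only at the goal, which has the largest possible rank; but here the maximal
       rank is attained off the diagonals, and the goal is on one. *)
    have [r [nr0 nr1 nr3]] := ord_avoid3 r0 r1 r1' k3.
    have := h r nr0; rewrite (negPf nr1) (negPf nr3) /= => -[/step_neq //|[ag _]].
    have le := at_goal_rank (p r2) en ag.
    have := mx r; rewrite (negPf nr1) (negPf nr3) /= => mr.
    have rE : rank (p r) = rank (p r2).
      by apply: anti_leq; rewrite le andbT; case/orP: mr => [/ltnW|/andP[]].
    have [] := rank_q rE; rewrite (at_goal_q ag) maxnn minnn => -> E.
    by move: hq E; clear; lia.
Qed.

(** * Asymmetric starts *)

Definition top n k (p : 'I_k -> node n) (r : 'I_k) : Prop :=
  forall r', rank (p r') <= rank (p r).

(** The last two clauses set aside the starts that are already in a final stage; the others need a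
    table. *)
Definition generic_start n k (p : 'I_k -> node n) : Prop :=
  [/\ injective p,
      (forall h, is_aut h -> (fun x => config p (h x)) = config p -> h =1 id),
      (forall r, top p r -> q (p r).1 != q (p r).2),
      (forall h, is_aut h -> ~ dominant 0 (fun x => config p (h x))) &
      (3 < k -> forall h v1 v2 v3, is_aut h ->
         ~ three_tops 0 (fun x => config p (h x)) v1 v2 v3)].

Lemma q_act n sw fx fy (v : node n) : ~~ odd n ->
  (q (act sw fx fy v).1 == q (act sw fx fy v).2) = (q v.1 == q v.2).
Proof. by move=> en; rewrite /act /= !q_flip //; case: sw => //; rewrite eq_sym. Qed.

Lemma generic_reframe n k (p : 'I_k -> node n) fx fy : ~~ odd n -> 1 < n ->
  generic_start p -> generic_start (fun r => act false fx fy (p r)).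
Proof.
move=> en n1 [inj asym nd ndom n3].
have sA := @is_aut_act n false fx fy; set s := act false fx fy in sA *.
have sK : cancel s s by exact: actK.
have cE : config (fun r => s (p r)) = fun v => config p (s v) by apply: config_aut.
have rs v : rank (s v) = rank v by apply: rank_aut.
split.
- by move=> r r' /(can_inj sK)/inj.
- move=> h hA; rewrite cE => E v.
  have := asym _ (is_aut_comp sA (is_aut_comp hA sA)).
  move=> /(_ _ (s v)) /=; rewrite sK => H; rewrite -{2}(sK v) -{}H ?sK //.
  apply: functional_extensionality => x.
  by have := congr1 (@^~ (s x)) E; rewrite /= sK.
- move=> r tr; rewrite q_act //; apply: nd => r'.
  by have := tr r'; rewrite !rs.
- by move=> h hA; rewrite cE; apply: ndom (is_aut_comp sA hA).
- by move=> k3 h v1 v2 v3 hA; rewrite cE; apply: n3 (is_aut_comp sA hA).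
Qed.

Lemma out_dominant n k (p : 'I_k -> node n) r w :
  QT (p r) -> top p r -> step (p r) w -> dominant 0 (config (upd p r w)).
Proof.
move=> Q tr st; have [Qw lt] := step_QT st Q.
exists w; split=> //; first by apply/config_neq0; exists r; rewrite /upd eqxx.
move=> v /config_neq0[r' <-]; rewrite /upd; case: eqP => _; first by rewrite Qw.
by move=> _; apply: leq_ltn_trans (tr r') lt.
Qed.

Lemma top_step n k (p : 'I_k -> node n) r : generic_start p -> top p r ->
  exists w, step (p r) w.
Proof.
move=> [_ _ nd _ _] /nd; have [w [st|[/at_goal_q ->]]] := go_exists (p r); first by exists w.
by rewrite eqxx.
Qed.

(** A table with one entry and two enabled robots: [r1] steps outwards, which makes its quadrant
    dominant, or [r2] goes to [w2]. If the latter gives three tops, [r1] must not be among the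
    waiting robots, as its move may be pending. *)
Lemma gatherable_one_step n k (p : 'I_k -> node n) r1 r2 w2 :
  ~~ odd n -> 1 < n -> 1 < k -> generic_start p ->
  r2 != r1 -> QT (p r1) -> top p r1 -> step (p r2) w2 ->
  dominant 0 (config (upd p r2 w2)) \/
  (3 < k /\ exists a b, three_top_robots 0 (upd p r2 w2) a b /\ r1 != a /\ r1 != b) ->
  gatherable_1crash p.
Proof.
move=> en n1 k1 gs nr Q1 t1 st2 H; have [inj asym nd ndom n3] := gs.
have [w1 st1] := top_step gs t1.
pose M r := if r == r1 then w1 else if r == r2 then w2 else p r.
have M1 : M r1 = w1 by rewrite /M eqxx.
have M2 : M r2 = w2 by rewrite /M (negPf nr) eqxx.
apply: (@gatherable_of_table n k p 0 unit (fun _ => True) (fun _ => p) (fun _ => M)) => //.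
- move=> _ r _; rewrite /M; have [->|_] := eqVneq r r1; first by right.
  by have [->|_] := eqVneq r r2; [right|left].
- by move=> _ _ h r r' _ _ hA /(asym h hA) hE; rewrite !hE => /inj->.
- by move=> _ h _; apply: ndom.
- by move=> _ h v1 v2 v3 _ hA k3; apply: n3.
- move=> _ r _; rewrite /M; have [->|nr1] := eqVneq r r1.
    by move=> _; constructor 1; apply: out_dominant.
  have [->|nr2] := eqVneq r r2 => // _.
  case: H => [dom|[k3 [a [b [t [na nb]]]]]]; [by constructor 1|constructor 3; split=> //].
  exists a, b; split=> // r' nr'; rewrite /M; have [->|] // := eqVneq r' r1.
  by rewrite (negPf nr').
- move=> _ r0 _; have [->|n0] := eqVneq r0 r1.
    by exists r2 => //; rewrite M2; apply: step_neq st2.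
  by exists r1; rewrite 1?eq_sym // M1; apply: step_neq st1.
by constructor 1; exists tt.
Qed.

Lemma gatherable_double n k (p : 'I_k -> node n) r1 r2 :
  ~~ odd n -> 1 < n -> 1 < k -> generic_start p ->
  r2 != r1 -> QT (p r1) -> QT (p r2) -> top p r1 -> top p r2 -> gatherable_1crash p.
Proof.
move=> en n1 k1 gs nr Q1 Q2 t1 t2; have [w2 st2] := top_step gs t2.
by apply: (gatherable_one_step en n1 k1 gs nr Q1 t1 st2); left; apply: out_dominant.
Qed.

(** Either [r1] steps outwards or [r2] inwards; both break the tie in favour of the quadrant of
    [r1]. *)
Lemma gatherable_two n k (p : 'I_k -> node n) r1 r2 :
  ~~ odd n -> 1 < n -> 1 < k -> generic_start p ->
  r2 != r1 -> QT (p r1) -> ~~ QT (p r2) -> top p r1 -> top p r2 ->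
  (forall r, r != r1 -> r != r2 -> rank (p r) < rank (p r1)) -> gatherable_1crash p.
Proof.
move=> en n1 k1 gs nr Q1 nQ2 t1 t2 lt; have [_ _ nd _ _] := gs.
have [w2 st2 w2P] := step_in en nQ2 (nd _ t2).
apply: (gatherable_one_step en n1 k1 gs nr Q1 t1 st2); left.
exists (p r1); split=> //.
  by apply/config_neq0; exists r1; rewrite /upd eq_sym (negPf nr).
move=> v /config_neq0[r <-]; rewrite /upd; have [_|nr2] := eqVneq r r2.
  by case/orP: w2P => [h|/andP[_ ->] //] _; apply: leq_trans h (t1 r2).
by have [->|nr1] := eqVneq r r1; [rewrite Q1|rewrite lt].
Qed.

(** Either [r1] steps outwards, or the opposite robot [r2] steps inwards and leaves three tops
    around [r1], where [a] and [b] wait. *)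
Lemma gatherable_four n k (p : 'I_k -> node n) r1 r2 a b :
  ~~ odd n -> 1 < n -> 3 < k -> generic_start p ->
  QT (p r1) -> ~~ sg (p r2).1 && ~~ sg (p r2).2 ->
  ~~ sg (p a).1 && sg (p a).2 -> sg (p b).1 && ~~ sg (p b).2 ->
  top p r1 -> top p r2 -> top p a -> top p b ->
  (forall r, r != r1 -> r != r2 -> r != a -> r != b -> rank (p r) < rank (p r1)) ->
  gatherable_1crash p.
Proof.
move=> en n1 k3 gs Q1 Q2 Qa Qb t1 t2 ta tb lt; have [_ _ nd _ _] := gs.
have k1 : 1 < k by apply: leq_trans k3.
have nQ2 : ~~ QT (p r2) by case/andP: Q2 => /negPf h _; rewrite /QT h.
have eqr r : top p r -> rank (p r) = rank (p r1).
  by move=> tr; apply: anti_leq; rewrite t1 tr.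
have neq r r' : (sg (p r).1, sg (p r).2) != (sg (p r').1, sg (p r').2) -> r != r'.
  by apply: contraNN => /eqP->.
have [h1 h2 h3 h4 h5] : [/\ r2 != r1, r1 != a, r1 != b, a != r2 & b != r2].
  by move: Q1 Q2 Qa Qb; rewrite /QT => /andP[a1 a2] /andP[/negPf b1 /negPf b2]
    /andP[/negPf c1 c2] /andP[d1 /negPf d2];
    split; apply: neq; rewrite ?a1 ?b1 ?c1 ?d1 ?a2 ?b2 ?c2 ?d2.
have [w2 st2] := step_in en nQ2 (nd _ t2).
case/andP: (Q2) => /negPf -> /negPf -> /= ; rewrite orbF => w2P.
apply: (gatherable_one_step en n1 k1 gs h1 Q1 t1 st2); right; split=> //.
exists a, b; split; last by [].
have ur r : r != r2 -> upd p r2 w2 r = p r by rewrite /upd => /negPf->.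
exists r1; rewrite !ur //; last by rewrite eq_sym.
split=> //; first by split; rewrite ?eqr // nd.
move=> r; have [->|nr2] := eqVneq r r2.
  by rewrite /upd eqxx -(eqr _ t2) w2P !orbT.
rewrite ur //; have [->|nr1] := eqVneq r r1; first by rewrite Q1 leqnn !orbT.
have [//|na] := eqVneq r a; have [|nb] //= := eqVneq r b.
by rewrite lt.
Qed.

Lemma config_two n k (p : 'I_k -> node n) r r' v :
  r != r' -> p r = v -> p r' = v -> config p v = 2.
Proof.
move=> nr pr pr'; rewrite /config.
have : #|[set r; r']| <= #|[pred x | p x == v]|.
  by apply: subset_leq_card; apply/subsetP => x; rewrite !inE => /orP[] /eqP->; rewrite ?pr ?pr'.
by rewrite cards2 nr; lia.
Qed.

Lemma config_one n k (p : 'I_k -> node n) r :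
  (forall r', p r' = p r -> r' = r) -> config p (p r) = 1.
Proof.
move=> u; rewrite /config (@eq_card1 _ r) // => r'; rewrite !inE.
by apply/eqP/eqP => [/u|->].
Qed.

(** With three robots the two neighbours cannot both wait, since [r2] may crash. A second entry
    helps: at first [r1] and [r2] are enabled, and once [r1] has stepped inwards, [r2] and [r3]. *)
Lemma gatherable_three n k (p : 'I_k -> node n) r1 r2 r3 :
  ~~ odd n -> 1 < n -> 1 < k -> ~~ (3 < k) -> generic_start p ->
  ~~ sg (p r1).1 && sg (p r1).2 -> QT (p r2) -> sg (p r3).1 && ~~ sg (p r3).2 ->
  top p r1 -> top p r2 -> top p r3 ->
  (forall r, [\/ r = r1, r = r2 | r = r3]) ->
  gatherable_1crash p.
Proof.
move=> en n1 k1 k3 gs /andP[/negPf a1 b1] Q2 /andP[a3 /negPf b3] t1 t2 t3 all.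
have [inj asym nd ndom _] := gs.
have /andP[a2 b2] := Q2.
have eqr r : top p r -> rank (p r) = rank (p r2).
  by move=> tr; apply: anti_leq; rewrite t2 tr.
have neq r r' : (sg (p r).1, sg (p r).2) != (sg (p r').1, sg (p r').2) -> r != r'.
  by apply: contraNN => /eqP->.
have [n12 n13 n23] : [/\ r1 != r2, r1 != r3 & r2 != r3].
  by split; apply: neq; rewrite ?a1 ?b1 ?a2 ?b2 ?a3 ?b3.
have nQ1 : ~~ QT (p r1) by rewrite /QT a1.
have nQ3 : ~~ QT (p r3) by rewrite /QT b3 andbF.
have [w1 st1] := step_in en nQ1 (nd _ t1); rewrite a1 b1 (eqr _ t1) /= => w1P.
have [w3 st3] := step_in en nQ3 (nd _ t3); rewrite a3 b3 (eqr _ t3) /= => w3P.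
have [w2 st2] := top_step gs t2.
pose p1 := upd p r1 w1.
have p1E : p1 r1 = w1 by rewrite /p1 /upd eqxx.
have p2E : p1 r2 = p r2 by rewrite /p1 /upd eq_sym (negPf n12).
have p3E : p1 r3 = p r3 by rewrite /p1 /upd eq_sym (negPf n13).
have occ1 v : config p1 v != 0 -> [\/ v = w1, v = p r2 | v = p r3].
  move=> /config_neq0[r <-].
  by case: (all r) => ->; [constructor 1|constructor 2|constructor 3].
have Qw1 : rank w1 = rank (p r2) -> QT w1.
  by move=> E; move: w1P; rewrite E ltnn.
have nw1 : w1 <> p r3.
  by move=> E; move: Qw1; rewrite E (eqr _ t3) (negPf nQ3) => /(_ erefl).
have o1 : config p1 w1 != 0 by apply/config_neq0; exists r1.
have o2 : config p1 (p r2) != 0 by apply/config_neq0; exists r2.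
have o3 : config p1 (p r3) != 0 by apply/config_neq0; exists r3.
(* In [p1] the occupied nodes of the former maximal rank all lie on the goal's side in the first
   coordinate, whereas the three quadrants met by [p] fit in no half of the grid. *)
have noiso g : is_aut g -> (forall r, config p1 (g (p r)) != 0) -> False.
  move=> gA occ.
  have sgT r : top p r -> sg (g (p r)).1.
    move=> tr; have E : rank (g (p r)) = rank (p r2) by rewrite (rank_aut _ en n1 gA) eqr.
    by case: (occ1 _ (occ r)) E => -> // /Qw1/andP[].
  have := (sgT r1 t1, sgT r2 t2, sgT r3 t3) => -[[]].
  have [sw [fx [fy gE]]] := is_aut_classify n1 gA; rewrite !gE /act /= !sg_flip //.
  by clear gE; case: sw; rewrite ?a1 ?b1 ?a2 ?b2 ?a3 ?b3; case: fx.
(* A nontrivial symmetry of [p1] could only be the reflection exchanging [p r2] and [p r3]. It fixes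
   no node, so [w1] would have to be [p r2], giving a multiplicity there but not at [p r3]. *)
have isoid h : is_aut h -> (fun x => config p1 (h x)) = config p1 -> h =1 id.
  move=> hA E.
  have occh v : config p1 v != 0 -> config p1 (h v) != 0.
    by rewrite -{1}E.
  have rh v : rank (h v) = rank v := rank_aut v en n1 hA.
  have toph v : config p1 v != 0 -> rank v = rank (p r2) -> QT v || (v == p r3).
    move=> /occ1[]->; rewrite ?eqxx ?orbT ?Q2 //.
    by move=> /Qw1->.
  have T2 := toph _ (occh _ o2) (rh _).
  have T3 := toph _ (occh _ o3) (etrans (rh _) (eqr _ t3)).
  have [Qh|nQh] := boolP (QT (h (p r2))).
    case: (aut_QT en hA Q2 Qh) => hE v; first by rewrite hE; case: v.
    move: T3; rewrite hE /QT /act /flip /= b3 /= => /eqP/(congr1 (fun v => sg v.1)) /=.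
    by rewrite b3 a3.
  move: T2; rewrite (negPf nQh) /= => /eqP h2.
  have inj_h : injective h by case: hA => /bij_inj.
  have Q3 : QT (h (p r3)).
    case/orP: T3 => // /eqP h3.
    have E32 : p r3 = p r2 by apply: inj_h; rewrite h2 h3.
    by move: nQ3; rewrite E32 Q2.
  have hE : h =1 act false false true.
    have [sw [fx [fy hE]]] := is_aut_classify n1 hA.
    have := congr1 (fun v => (sg v.1, sg v.2)) h2; move: Q3.
    rewrite !hE /QT /act /= !sg_flip //.
    by case: sw hE => hE /=; rewrite a2 b2 a3 b3; case: fx hE; case: fy.
  have nofix v : h v <> v.
    rewrite hE => /(congr1 (fun v : node n => sg v.2)).
    by rewrite /act /= (@sg_flip n true) //; case: (sg _).
  case: (occ1 _ (occh _ o1)) => [/nofix //|h1|h1].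
    have : h (p r2) = h (h w1) by rewrite h1.
    rewrite h2 !hE (_ : act _ _ _ _ = w1) => [/esym/nw1 //|].
    exact: (@actK n false false true).
  have E12 : w1 = p r2 by apply: inj_h; rewrite h1 h2.
  have := congr1 (@^~ (p r2)) E; rewrite /= h2.
  rewrite (@config_two n k p1 r1 r2 (p r2)) // ?p1E ?E12 //.
  rewrite -{1}p3E config_one // => r.
  case: (all r) => -> //; rewrite ?p1E ?p2E p3E => // /inj E23.
  by rewrite E23 eqxx in n23.
pose P b := if b then p1 else p.
(* Destinations are attached to nodes: [r1] may land on the node of [r2], and then both must behave
   alike. *)
pose M (b : bool) r := if P b r == p r2 then w2 else
  if b then (if p1 r == p r3 then w3 else p1 r) else (if r == r1 then w1 else p r).
have Mf2 : M false r2 = w2 by rewrite /M eqxx.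
have Mf1 : M false r1 = w1 by rewrite /M /= (inj_eq inj) (negPf n12) eqxx.
have Mf3 : M false r3 = p r3.
  by rewrite /M /= (inj_eq inj) eq_sym (negPf n23) eq_sym (negPf n13).
have Mt2 : M true r2 = w2 by rewrite /M /= p2E eqxx.
have Mt3 : M true r3 = w3.
  by rewrite /M /= p3E (inj_eq inj) eq_sym (negPf n23) eqxx.
have Mt1 : M true r1 = if w1 == p r2 then w2 else w1.
  by rewrite /M /= p1E (_ : w1 == p r3 = false) //; apply/eqP.
have top1 r : p1 r = p r2 -> top p1 r.
  move=> E r'; rewrite E; case: (all r') => ->; rewrite ?p1E ?p2E ?p3E ?(eqr _ t3) //.
  by case/orP: w1P => [/ltnW //|/step_QT]; rewrite -(eqr _ t1) => _; apply: step_out st1 nQ1.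
apply: (@gatherable_of_table n k p 0 bool (fun _ => True) P M) => //.
- move=> b r _; rewrite /M; case: b => /=; case: eqP => [->|_].
  + by right.
  + by case: eqP => [->|]; [right|left].
  + by right.
  + by have [->|_] := eqVneq r r1; [right|left].
- move=> b b' h r r' _ _ hA; case: b; case: b' => E /=.
  + have hE := isoid h hA E; rewrite !hE /M /= => ->; by [].
  + case: (noiso h hA) => r''; have := congr1 (@^~ (p r'')) E; rewrite /= => ->.
    by apply/config_neq0; exists r''.
  + have [g gA [hK gK]] := is_aut_inv hA.
    case: (noiso g gA) => r''; have := congr1 (@^~ (g (p r''))) E; rewrite /= gK => <-.
    by apply/config_neq0; exists r''.
  + by have hE := asym h hA E; rewrite !hE => /inj->.
- move=> b h _ hA; case: b => /=; last exact: ndom.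
  move=> [v0 [o0 Q0 _ m0]].
  have [g gA [hK gK]] := is_aut_inv hA.
  have rg v : rank (g v) = rank v := rank_aut v en n1 gA.
  have gQ r : config p1 (p r) != 0 -> top p r -> QT (g (p r)).
    move=> o tr; apply/negPn/negP => nQ; have := m0 (g (p r)).
    rewrite gK rg => /(_ o nQ); rewrite ltnNge -(rank_aut v0 en n1 hA).
    case/config_neq0: o0 => r' <-; rewrite (eqr _ tr) -p2E.
    by rewrite top1.
  have [_] := aut_quadrant en n1 gA (gQ _ o2 t2) (gQ _ o3 t3).
  by rewrite b2 b3.
- by move=> b h v1 v2 v3 _ _; rewrite (negPf k3).
- move=> b r _; case: b; case: (all r) => ->;
    rewrite /= ?Mt1 ?Mt2 ?Mt3 ?Mf1 ?Mf2 ?Mf3 ?p1E ?p2E ?p3E => ne //.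
  + constructor 1; move: ne; case: eqP => // E _.
    by apply: out_dominant; rewrite ?p1E ?E //; apply: top1; rewrite p1E.
  + by constructor 1; apply: out_dominant; rewrite ?p2E //; apply: top1.
  + constructor 1; exists (p r2); split=> //.
      by apply/config_neq0; exists r2; rewrite /upd (negPf n23).
    move=> v /config_neq0[r' <-]; rewrite /upd; have [_|nr3] := eqVneq r' r3.
      by case/orP: w3P => // ->.
    case: (all r') nr3 => ->; rewrite ?eqxx // ?p1E ?p2E ?Q2 // => _.
    by case/orP: w1P => // ->.
  + constructor 2; exists true => // r'; case: (all r') => ->; rewrite ?eqxx // => _.
    * by right; rewrite Mf2 Mt2.
    * by left.
  + by constructor 1; apply: out_dominant.
- move=> b r0 _; case: b.
  + have [->|n0] := eqVneq r0 r2.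
      by exists r3; rewrite 1?eq_sym // Mt3 /= p3E; apply: step_neq st3.
    by exists r2; rewrite 1?eq_sym // Mt2 /= p2E; apply: step_neq st2.
  + have [->|n0] := eqVneq r0 r2.
      by exists r1; rewrite // Mf1; apply: step_neq st1.
    by exists r2; rewrite 1?eq_sym // Mf2; apply: step_neq st2.
by constructor 1; exists false.
Qed.

Lemma top_exists n k (p : 'I_k -> node n) : 0 < k -> exists r, top p r.
Proof.
move=> k0; case: (@arg_maxnP _ (Ordinal k0) xpredT (fun r => rank (p r))) => // r _ h.
by exists r => r'; apply: h.
Qed.

Lemma not_top_lt n k (p : 'I_k -> node n) a r : top p a -> ~ top p r ->
  rank (p r) < rank (p a).
Proof.
move=> ta nt; rewrite ltnNge; apply/negP => le; apply: nt => r'.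
by apply: leq_trans (ta r') le.
Qed.

(** With four robots or more this is a configuration with three tops, which [generic_start]
    excludes; so there are only three robots. *)
Lemma gatherable_three_tops n k (p : 'I_k -> node n) r1 r2 r3 :
  ~~ odd n -> 1 < n -> 1 < k -> generic_start p ->
  ~~ sg (p r1).1 && sg (p r1).2 -> QT (p r2) -> sg (p r3).1 && ~~ sg (p r3).2 ->
  top p r1 -> top p r2 -> top p r3 ->
  (forall r, top p r -> [\/ r = r1, r = r2 | r = r3]) ->
  gatherable_1crash p.
Proof.
move=> en n1 k1 gs s1 Q2 s3 t1 t2 t3 only.
have [inj asym nd ndom n3] := gs.
have eqr r : top p r -> rank (p r) = rank (p r2).
  by move=> tr; apply: anti_leq; rewrite t2 tr.
have [k3|nk3] := boolP (3 < k).
  have [v2 t] : exists v2, three_tops 0 (config p) (p r1) v2 (p r3).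
    apply: three_top_robots_config; exists r2; split=> //.
      by split; rewrite ?eqr // nd.
    move=> r; case: (classic (top p r)) => [/only[]->|nt]; rewrite ?eqxx ?orbT //.
      by rewrite Q2 leqnn !orbT.
    by rewrite (not_top_lt t2 nt) !orbT.
  by case: (n3 k3 (fun v => v) (p r1) v2 (p r3)) => //; apply: is_aut_id.
apply: (gatherable_three en n1 k1 nk3 gs s1 Q2 s3 t1 t2 t3) => r.
have neq x y : (sg (p x).1, sg (p x).2) != (sg (p y).1, sg (p y).2) -> x != y.
  by apply: contraNN => /eqP->.
have u : uniq [:: r1; r2; r3].
  move: s1 Q2 s3; rewrite /QT => /andP[/negPf a1 b1] /andP[a2 b2] /andP[a3 /negPf b3].
  rewrite /= !inE !negb_or !neq // ?a1 ?b1 ?a2 ?b2 ?a3 ?b3 //.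
have [E1|m1] := eqVneq r r1; first by constructor 1.
have [E2|m2] := eqVneq r r2; first by constructor 2.
have [E3|m3] := eqVneq r r3; first by constructor 3.
have u' : uniq [:: r; r1; r2; r3] by rewrite cons_uniq u !inE !negb_or m1 m2 m3.
by have := max_card (mem [:: r; r1; r2; r3]); rewrite (card_uniqP u') card_ord (negPf nk3).
Qed.

Lemma top_act n k (p : 'I_k -> node n) fx fy r : ~~ odd n ->
  top (fun r => act false fx fy (p r)) r <-> top p r.
Proof. by move=> en; split=> h r'; have := h r'; rewrite !rank_act. Qed.

Lemma gatherable_generic n k (p : 'I_k -> node n) :
  ~~ odd n -> 1 < n -> 1 < k -> generic_start p -> gatherable_1crash p.
Proof.
move=> en n1 k1 gs0.
have [[r [r' [nr [tr [tr' [E1 E2]]]]]]|nodouble] := classic (exists r r',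
    r' != r /\ top p r /\ top p r' /\ sg (p r').1 = sg (p r).1 /\ sg (p r').2 = sg (p r).2).
  apply: (@gatherable_reframe _ _ (act false (~~ sg (p r).1) (~~ sg (p r).2))).
    exact: is_aut_act.
  apply: (gatherable_double en n1 k1 (generic_reframe _ _ en n1 gs0) nr); rewrite ?top_act //;
    by rewrite /QT /act /= !sg_flip // ?E1 ?E2; case: (sg (p r).1); case: (sg (p r).2).
have [a ta] := top_exists p (ltnW k1).
apply: (@gatherable_reframe _ _ (act false (~~ sg (p a).1) (~~ sg (p a).2))).
  exact: is_aut_act.
set p' := fun r => _.
have gs : generic_start p' by apply: generic_reframe.
have tE r : top p' r <-> top p r by apply: top_act.
have Qa : QT (p' a).
  by rewrite /QT /p' /act /= !sg_flip //; case: (sg (p a).1); case: (sg (p a).2).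
have uq r r' : top p' r -> top p' r' -> sg (p' r).1 = sg (p' r').1 ->
    sg (p' r).2 = sg (p' r').2 -> r = r'.
  move=> /tE tr /tE tr'; rewrite /p' /act /= !sg_flip // => /addIb e1 /addIb e2.
  apply/eqP/negPn/negP => nr; apply: nodouble; by exists r', r.
move/tE: ta => {tE nodouble gs0} ta.
move: p' gs Qa ta uq => {}p gs Qa ta uq.
have [inj asym nd ndom n3] := gs.
have /andP[a1 a2] := Qa.
have ex (x y : bool) : (exists2 b, top p b & sg (p b).1 = x /\ sg (p b).2 = y) \/
    (forall b, top p b -> sg (p b).1 = x -> sg (p b).2 = y -> False).
  case: (classic (exists2 b, top p b & sg (p b).1 = x /\ sg (p b).2 = y)); first by left.
  by move=> h; right=> b tb e1 e2; apply: h; exists b.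
have quad r : top p r -> [\/ [/\ sg (p r).1 = true, sg (p r).2 = true & r = a],
   sg (p r).1 = false /\ sg (p r).2 = true, sg (p r).1 = false /\ sg (p r).2 = false |
   sg (p r).1 = true /\ sg (p r).2 = false].
  move=> tr; case E1: (sg (p r).1); case E2: (sg (p r).2).
  - by constructor 1; split=> //; apply: uq; rewrite ?a1 ?a2.
  - by constructor 4.
  - by constructor 2.
  - by constructor 3.
have two b : top p b -> ~~ QT (p b) -> (forall r, top p r -> r = a \/ r = b) ->
    gatherable_1crash p.
  move=> tb nQb only; apply: (gatherable_two en n1 k1 gs _ Qa nQb ta tb).
    by apply/eqP => E; rewrite E Qa in nQb.
  move=> r /eqP na /eqP nb; apply: (not_top_lt ta) => /only[]; by [].
(* Each quadrant now holds at most one outermost robot, and [a] is the one in the goal quadrant; the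
   cases are the other quadrants met. When three tie, a reflection, if necessary, makes the middle
   one the goal quadrant. *)
have [[b tb [b1 b2]]|nb] := ex false true; have [[c tc [c1 c2]]|nc] := ex false false;
  have [[d td [d1 d2]]|nd'] := ex true false.
- have k3 : 3 < k.
    have u : uniq [:: a; b; c; d].
      have neq x y : (sg (p x).1, sg (p x).2) != (sg (p y).1, sg (p y).2) -> x != y.
        by apply: contraNN => /eqP->.
      by rewrite /= !inE !negb_or !neq // ?a1 ?b1 ?c1 ?d1 ?a2 ?b2 ?c2 ?d2.
    by have := max_card (mem [:: a; b; c; d]); rewrite (card_uniqP u) card_ord.
  apply: (gatherable_four (r1 := a) (r2 := c) (a := b) (b := d)) => //;
    rewrite ?b1 ?b2 ?c1 ?c2 ?d1 ?d2 //.
  move=> r /eqP na /eqP nc /eqP nb /eqP nd'; apply: (not_top_lt ta) => tr.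
  case: (quad r tr) => [[_ _ //]|[e1 e2]|[e1 e2]|[e1 e2]].
  + by apply: nb; apply: uq => //; rewrite ?e1 ?e2 ?b1 ?b2.
  + by apply: nc; apply: uq => //; rewrite ?e1 ?e2 ?c1 ?c2.
  + by apply: nd'; apply: uq => //; rewrite ?e1 ?e2 ?d1 ?d2.
- apply: (@gatherable_reframe _ _ (act false true false)); first exact: is_aut_act.
  apply: (gatherable_three_tops (r1 := a) (r2 := b) (r3 := c)) => //; rewrite ?top_act //.
  + exact: generic_reframe.
  + by rewrite /act /= (@sg_flip n true) // a1 a2.
  + by rewrite /QT /act /= (@sg_flip n true) // b1 b2.
  + by rewrite /act /= (@sg_flip n true) // c1 c2.
  move=> r; rewrite top_act // => tr.
  case: (quad r tr) => [[_ _ //]|[e1 e2]|[e1 e2]|[e1 e2]].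
  + by constructor 1.
  + by constructor 2; apply: uq => //; rewrite ?e1 ?e2 ?b1 ?b2.
  + by constructor 3; apply: uq => //; rewrite ?e1 ?e2 ?c1 ?c2.
  + by case: (nd' r tr).
- apply: (gatherable_three_tops (r1 := b) (r2 := a) (r3 := d)) => //;
    rewrite ?b1 ?b2 ?d1 ?d2 //.
  move=> r tr; case: (quad r tr) => [[_ _ //]|[e1 e2]|[e1 e2]|[e1 e2]].
  + by constructor 2.
  + by constructor 1; apply: uq => //; rewrite ?e1 ?e2 ?b1 ?b2.
  + by case: (nc r tr).
  + by constructor 3; apply: uq => //; rewrite ?e1 ?e2 ?d1 ?d2.
- apply: (two b tb); first by rewrite /QT b1.
  move=> r tr; case: (quad r tr) => [[_ _ //]|[e1 e2]|[e1 e2]|[e1 e2]].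
  + by left.
  + by right; apply: uq => //; rewrite ?e1 ?e2 ?b1 ?b2.
  + by case: (nc r tr).
  + by case: (nd' r tr).
- apply: (@gatherable_reframe _ _ (act false false true)); first exact: is_aut_act.
  apply: (gatherable_three_tops (r1 := c) (r2 := d) (r3 := a)) => //; rewrite ?top_act //.
  + exact: generic_reframe.
  + by rewrite /act /= (@sg_flip n true) // c1 c2.
  + by rewrite /QT /act /= (@sg_flip n true) // d1 d2.
  + by rewrite /act /= (@sg_flip n true) // a1 a2.
  move=> r; rewrite top_act // => tr.
  case: (quad r tr) => [[_ _ //]|[e1 e2]|[e1 e2]|[e1 e2]].
  + by constructor 3.
  + by case: (nb r tr).
  + by constructor 1; apply: uq => //; rewrite ?e1 ?e2 ?c1 ?c2.
  + by constructor 2; apply: uq => //; rewrite ?e1 ?e2 ?d1 ?d2.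
- apply: (two c tc); first by rewrite /QT c1.
  move=> r tr; case: (quad r tr) => [[_ _ //]|[e1 e2]|[e1 e2]|[e1 e2]].
  + by left.
  + by case: (nb r tr).
  + by right; apply: uq => //; rewrite ?e1 ?e2 ?c1 ?c2.
  + by case: (nd' r tr).
- apply: (two d td); first by rewrite /QT d2 andbF.
  move=> r tr; case: (quad r tr) => [[_ _ //]|[e1 e2]|[e1 e2]|[e1 e2]].
  + by left.
  + by case: (nb r tr).
  + by case: (nc r tr).
  + by right; apply: uq => //; rewrite ?e1 ?e2 ?d1 ?d2.
(* Only [a] is outermost, so its quadrant would already be dominant. *)
case: (ndom (fun v => v)); first exact: is_aut_id.
exists (p a); split=> //; first by apply/config_neq0; exists a.
move=> v /config_neq0[r <-] nQ; apply: (not_top_lt ta) => tr.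
case: (quad r tr) => [[e1 e2 _]|[e1 e2]|[e1 e2]|[e1 e2]].
- by move: nQ; rewrite /QT e1 e2.
- exact: (nb r tr).
- exact: (nc r tr).
- exact: (nd' r tr).
Qed.

(** The start is already in a final stage, so the empty table serves. *)
Lemma gatherable_of_dominant n k (p : 'I_k -> node n) h th :
  ~~ odd n -> 1 < n -> 1 < k -> is_aut h ->
  dominant th (fun x => config p (h x)) -> gatherable_1crash p.
Proof.
move=> en n1 k1 hA dom; have [g gA [hK gK]] := is_aut_inv hA.
apply: (@gatherable_reframe _ _ g) => //.
apply: (@gatherable_of_table n k _ th False (fun _ => False) (fun _ => p) (fun _ => p)) => //.
by constructor 2; rewrite (config_aut p gK hK).
Qed.

Lemma gatherable_of_three_tops n k (p : 'I_k -> node n) h th v1 v2 v3 :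
  ~~ odd n -> 1 < n -> 3 < k -> injective p -> is_aut h ->
  three_tops th (fun x => config p (h x)) v1 v2 v3 -> gatherable_1crash p.
Proof.
move=> en n1 k3 inj hA t; have [g gA [hK gK]] := is_aut_inv hA.
apply: (@gatherable_reframe _ _ g) => //.
set p' := fun r => _.
have cE : config p' = fun x => config p (h x) by apply: config_aut.
have inj' : injective p' by move=> r r' /(can_inj gK)/inj.
rewrite -cE in t; have [[f1 f2 f3] ts tr mx] := t.
move: f1 f2 f3 ts tr mx => {t} /config_neq0[r1 <-] /config_neq0[r2 <-] /config_neq0[r3 <-] ts tr mx.
apply: (@gatherable_of_table n k _ th False (fun _ => False) (fun _ => p) (fun _ => p)) => //.
  by apply: leq_trans k3.
constructor 3; split=> //; exists r1, r3, r2; split=> // r.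
have /mx : config p' (p' r) != 0 by apply/config_neq0; exists r.
by rewrite !(inj_eq inj').
Qed.

Lemma gatherable_asymmetric n k (p : 'I_k -> node n) :
  ~~ odd n -> 1 < n -> 1 < k -> injective p ->
  (forall h, is_aut h -> (fun x => config p (h x)) = config p -> h =1 id) ->
  (forall r, top p r -> q (p r).1 != q (p r).2) ->
  gatherable_1crash p.
Proof.
move=> en n1 k1 inj asym nd.
case: (classic (exists h, is_aut h /\ dominant 0 (fun x => config p (h x)))) => [[h [hA dom]]|ndom].
  exact: gatherable_of_dominant dom.
case: (classic (3 < k /\ exists h v1 v2 v3, is_aut h /\
    three_tops 0 (fun x => config p (h x)) v1 v2 v3)) => [[k3 [h [v1 [v2 [v3 [hA t]]]]]]|n3].
  exact: gatherable_of_three_tops t.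
apply: gatherable_generic => //; split=> //.
- by move=> h hA dom; apply: ndom; exists h.
- by move=> k3 h v1 v2 v3 hA t; apply: n3; split=> //; exists h, v1, v2, v3.
Qed.

(** * Diagonally symmetric starts *)

Lemma q_half n (a : 'I_n) : ~~ odd n -> q a < n./2.
Proof. by move=> en; rewrite /q; case: a => a /=; case: ifP => h l; lia. Qed.

Lemma in_square_q n d (v : node n) : ~~ odd n -> d <= n./2 ->
  in_square d v = (q v.1 < d) && (q v.2 < d).
Proof.
move=> en dn; rewrite /in_square /q; case: v => [[a la] [b lb]] /=.
by repeat case: ifP => ?; lia.
Qed.

Lemma is_corner_q n d (v : node n) : ~~ odd n -> d < n./2 ->
  is_corner d.+1 v = (q v.1 == d) && (q v.2 == d).
Proof.
move=> en dn; rewrite /is_corner /q; case: v => [[a la] [b lb]] /=.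
by repeat case: ifP => ?; lia.
Qed.

(** Here [d] is the largest [q] of an occupied node. The enclosing square has half-side [d.+1],
    since the middle lines are at distance 0. *)
Lemma enclosing_square n k (p : 'I_k -> node n) : ~~ odd n -> 0 < k ->
  mes_corners_empty (config p) ->
  exists d, [/\ forall r, q (p r).1 <= d /\ q (p r).2 <= d,
    exists r, q (p r).1 = d \/ q (p r).2 = d &
    forall r, ~ (q (p r).1 = d /\ q (p r).2 = d)].
Proof.
move=> en k0 mc.
have [r rmax] : exists r, forall r', maxn (q (p r').1) (q (p r').2) <= maxn (q (p r).1) (q (p r).2).
  case: (@arg_maxnP _ (Ordinal k0) xpredT (fun r => maxn (q (p r).1) (q (p r).2))) => // r _ h.
  by exists r => r'; apply: h.
have h1 := q_half (p r).1 en; have h2 := q_half (p r).2 en.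
exists (maxn (q (p r).1) (q (p r).2)); set d := maxn _ _ in rmax *.
have dn : d < n./2 by rewrite /d gtn_max h1 h2.
have le r' : q (p r').1 <= d /\ q (p r').2 <= d.
  by have := rmax r'; rewrite geq_max => /andP.
split=> //; first by exists r; rewrite /d; clear; lia.
move=> r' [e1 e2]; have : config p (p r') = 0.
  apply: (mc d.+1); last by rewrite is_corner_q // e1 e2 eqxx.
  split; first by [].
  split.
    move=> v /config_neq0[r'' <-]; rewrite in_square_q // !ltnS.
    by have [-> ->] := le r''.
  move=> d' /andP[d0 d'd] enc.
  have : in_square d' (p r) by apply: enc; apply/config_neq0; exists r.
  rewrite in_square_q; first by move=> /andP[l1 l2]; move: d'd; rewrite /d; clear -l1 l2; lia.
    by [].
  by apply: leq_trans dn; move: d'd; clear; lia.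
by apply/eqP; apply/config_neq0; exists r'.
Qed.

(** * Invariants of configurations on distinct nodes *)

Lemma config_inj n k (p : 'I_k -> node n) v : injective p ->
  config p v = [exists r, p r == v].
Proof.
move=> inj; case: existsP => [[r /eqP <-]|no].
  by rewrite config_one // => r' /inj.
apply/eqP/negPn/negP => /config_neq0[r E]; apply: no; exists r; exact/eqP.
Qed.

Lemma config_ext n k (p p' : 'I_k -> node n) : injective p -> injective p' ->
  (forall v, (exists r, p r = v) <-> (exists r, p' r = v)) -> config p = config p'.
Proof.
move=> inj inj' E; apply: functional_extensionality => v; rewrite !config_inj //.
congr nat_of_bool; apply/existsP/existsP => -[r /eqP pr].
  by have [r' pr'] := proj1 (E v) (ex_intro _ r pr); exists r'; apply/eqP.
by have [r' pr'] := proj2 (E v) (ex_intro _ r pr); exists r'; apply/eqP.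
Qed.

(** An isomorphism onto a configuration of robots on distinct nodes matches the robots
    bijectively. *)
Lemma config_iso_sum n k (p p' : 'I_k -> node n) (h : node n -> node n) (g : node n -> int) :
  injective p' -> is_aut h -> (fun x => config p (h x)) = config p' ->
  (\sum_r g (p r) = \sum_r g (h (p' r)))%R.
Proof.
move=> inj' hA E.
have ex r : exists r', p r' == h (p' r).
  have : config p (h (p' r)) != 0.
    by have := congr1 (@^~ (p' r)) E => /= ->; apply/config_neq0; exists r.
  by move=> /config_neq0[r' <-]; exists r'.
pose pi r := xchoose (ex r).
have piE r : p (pi r) = h (p' r) by apply/eqP; apply: (xchooseP (ex r)).
have pi_inj : injective pi.
  move=> r r' /(congr1 p); rewrite !piE => e; apply: inj'.
  by case: hA => /bij_inj hi _; apply: hi.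
rewrite (reindex_inj pi_inj) /=; apply: eq_bigr => r _; by rewrite piE.
Qed.

(** Twice the signed distance to the centre line, with a bonus on the line [D] and a malus on its
    mirror line: an odd function under reflection. *)
Definition omega n (D : 'I_n) (K : nat) (a : 'I_n) : int :=
  ((a : nat)%:Z + (a : nat)%:Z + 1 - n%:Z + (if a == D then K%:Z else 0)
    - (if a == rev_ord D then K%:Z else 0))%R.

Lemma omega_rev n (D : 'I_n) K a : omega D K (rev_ord a) = (- omega D K a)%R.
Proof.
rewrite /omega (inj_eq rev_ord_inj) -(inj_eq rev_ord_inj (rev_ord a)) rev_ordK /=.
have := ltn_ord a; case: (a == D); case: (a == rev_ord D) => /=; lia.
Qed.

(** A single bonus [(k * n).+1] outweighs the linear terms of all robots together. *)
Definition weight n k (D : 'I_n) (p : 'I_k -> node n) : int :=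
  (\sum_r omega D (k * n).+1 (p r).1)%R.

Definition weight2 n k (D : 'I_n) (p : 'I_k -> node n) : int :=
  (\sum_r omega D (k * n).+1 (p r).2)%R.

Lemma weight_iso n k (D : 'I_n) (p p' : 'I_k -> node n) sw fx fy :
  injective p' -> (fun x => config p (act sw fx fy x)) = config p' ->
  weight D p = (let w := if sw then weight2 D p' else weight D p' in if fx then - w else w)%R /\
  weight2 D p = (let w := if sw then weight D p' else weight2 D p' in if fy then - w else w)%R.
Proof.
move=> inj' E; have hA := @is_aut_act n sw fx fy.
rewrite /weight /weight2.
rewrite (config_iso_sum (fun v => omega D (k * n).+1 v.1) inj' hA E).
rewrite (config_iso_sum (fun v => omega D (k * n).+1 v.2) inj' hA E).
rewrite /act /=.
by case: sw {E hA}; case: fx; case: fy; rewrite /= -?sumrN; split; apply: eq_bigr => r _;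
  rewrite /flip ?omega_rev.
Qed.

Lemma weight_side n k (D : 'I_n) (p : 'I_k -> node n) r :
  (0 <= weight D p)%R -> (p r).1 = rev_ord D -> exists r', (p r').1 = D.
Proof.
move=> W0 pr; case: (classic (exists r', (p r').1 = D)) => // no.
suff : (weight D p < 0)%R by rewrite Order.TotalTheory.ltNge W0.
have le r' : (omega D (k * n).+1 (p r').1 <= n%:Z - (if r' == r then (k * n).+1%:Z else 0))%R.
  rewrite /omega; case: eqP => [e|_]; first by case: no; exists r'.
  have := ltn_ord (p r').1; case: (eqVneq r' r) => [->|_].
    rewrite pr eqxx; lia.
  by case: ifP => _; lia.
have : (weight D p <= \sum_(r' < k) (n%:Z - (if r' == r then (k * n).+1%:Z else 0)))%R.
  by apply: ler_sum => r' _.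
rewrite sumrB sumr_const card_ord -big_mkcond big_pred1_eq.
by rewrite -mulr_natr; move: (weight D p) => w; nia.
Qed.

(** * Positions with two robots sliding towards a corner *)

Definition slide n k (p : 'I_k -> node n) (D : 'I_n) (r1 r2 : 'I_k) (a b : 'I_n)
  : 'I_k -> node n :=
  fun r => if r == r1 then (D, a) else if r == r2 then (b, D) else p r.

(* Diagonally symmetric start: [r1] is the robot of the side [x = D] of the
   enclosing square nearest to the corner [(D, D)], and [r2] is its mirror image. *)
Definition mirror_start n k (p : 'I_k -> node n) (D : 'I_n) (r1 r2 : 'I_k) : Prop :=
  [/\ [/\ ~~ odd n, n./2 <= D & injective p],
      (forall v, (exists r, p r = v) -> exists r, p r = (v.2, v.1)),
      (forall fx fy, fx || fy ->
         (fun x => config p (act false fx fy x)) <> config p),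
      [/\ (p r1).1 = D, p r2 = ((p r1).2, D), (p r1).2 < D & rev_ord D < (p r1).2] &
      (forall r, (p r).1 = D -> (p r).2 <= (p r1).2) /\
      [/\ (forall r, q (p r).1 <= q D /\ q (p r).2 <= q D),
          (forall r, ~ (q (p r).1 = q D /\ q (p r).2 = q D)) & (0 <= weight D p)%R]].

Lemma slide_r1 n k (p : 'I_k -> node n) D r1 r2 a b : slide p D r1 r2 a b r1 = (D, a).
Proof. by rewrite /slide eqxx. Qed.

Lemma slide_r2 n k (p : 'I_k -> node n) D r1 r2 a b : r2 != r1 ->
  slide p D r1 r2 a b r2 = (b, D).
Proof. by rewrite /slide eqxx => /negPf->. Qed.

Lemma slide_other n k (p : 'I_k -> node n) D r1 r2 a b r : r != r1 -> r != r2 ->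
  slide p D r1 r2 a b r = p r.
Proof. by rewrite /slide => /negPf-> /negPf->. Qed.

Lemma mirror_neq n k (p : 'I_k -> node n) D r1 r2 : mirror_start p D r1 r2 -> r2 != r1.
Proof.
move=> [_ _ _ [_ e2 lt _] _]; apply/eqP => E.
have E2 : (p r1).2 = D by rewrite -{1}E e2.
by rewrite E2 ltnn in lt.
Qed.

(** The nodes between [r1] and the corner are free because [r1] is the nearest robot of its side;
    the diagonal symmetry gives the same for [r2]. *)
Lemma slide_inj n k (p : 'I_k -> node n) (D : 'I_n) r1 r2 (a b : 'I_n) :
  mirror_start p D r1 r2 ->
  (p r1).2 <= a -> (p r1).2 <= b -> a < D -> b < D -> injective (slide p D r1 r2 a b).
Proof.
move=> ms; have nr := mirror_neq ms; move: ms.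
move=> [[en hD inj] sym _ [e1 e2 lt lt'] [mx _]] ya yb aD bD.
have c1 r : r != r1 -> p r <> (D, a).
  move=> nr1 E; have := mx r; rewrite E /= => /(_ erefl) ay.
  have Ea : a = (p r1).2 by apply: ord_inj; apply: anti_leq; rewrite ay ya.
  case/eqP: nr1; apply: inj; rewrite E Ea -e1; by case: (p r1).
have c2 r : r != r2 -> p r <> (b, D).
  move=> nr2 E; have [r' E'] := sym (b, D) (ex_intro _ r E).
  have := mx r'; rewrite E' /= => /(_ erefl) bY.
  have Eb : b = (p r1).2 by apply: ord_inj; apply: anti_leq; rewrite bY yb.
  by case/eqP: nr2; apply: inj; rewrite E e2 Eb.
have c3 : (D, a) <> (b, D) :> node n by case=> _ E; rewrite E ltnn in aD.
move=> r r'; rewrite /slide.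
have [->|m1] := eqVneq r r1; have [->|m1'] := eqVneq r' r1 => //.
- have [->|m2'] := eqVneq r' r2 => //.
  by move=> /esym/(c1 _ m1').
- have [->|m2] := eqVneq r r2; first by move=> /esym/c3.
  by move=> /(c1 _ m1).
have [->|m2] := eqVneq r r2; have [->|m2'] := eqVneq r' r2 => //.
- by move=> /esym/(c2 _ m2').
- by move=> /(c2 _ m2).
- by move=> /inj.
Qed.

Lemma slide_swap n k (p : 'I_k -> node n) (D : 'I_n) r1 r2 (a b : 'I_n) :
  mirror_start p D r1 r2 ->
  (p r1).2 <= a -> (p r1).2 <= b -> a < D -> b < D ->
  config (slide p D r1 r2 b a) =
  (fun v => config (slide p D r1 r2 a b) (act true false false v)).
Proof.
move=> ms ya yb aD bD; have nr := mirror_neq ms.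
have tK : cancel (@act n true false false) (act true false false) := @actK n true false false.
rewrite -(config_aut _ tK tK).
have inj1 := slide_inj ms ya yb aD bD; have inj2 := slide_inj ms yb ya bD aD.
have sym : forall v, (exists r, p r = v) -> exists r, p r = (v.2, v.1) by case: ms.
have [e1 e2 inj] : [/\ (p r1).1 = D, p r2 = ((p r1).2, D) & injective p]
  by case: ms => [[]] ? ? ? ? ? [].
have e1' : p r1 = (D, (p r1).2) by rewrite -e1; case: (p r1).
have main a' b' v : (exists r, slide p D r1 r2 a' b' r = v) ->
    exists r, slide p D r1 r2 b' a' r = (v.2, v.1).
  move=> [r <-]; have [->|m1] := eqVneq r r1.
    by exists r2; rewrite slide_r1 slide_r2.
  have [->|m2] := eqVneq r r2.
    by exists r1; rewrite slide_r1 slide_r2.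
  rewrite slide_other //.
  have [r' E] := sym (p r) (ex_intro _ r erefl).
  exists r'; rewrite slide_other //; apply/eqP => E'; rewrite E' in E.
    case/eqP: m2; apply: inj; rewrite e2; move: E; rewrite e1'.
    by case: (p r) => x y /= [-> ->].
  case/eqP: m1; apply: inj; rewrite e1'; move: E; rewrite e2.
  by case: (p r) => x y /= [-> ->].
apply: config_ext => //; first by move=> r r' /(can_inj tK)/inj1.
move=> v; split=> [/main[r E]|[r <-]].
  by exists r; rewrite E /act; case: v {E}.
exact: (main a b _ (ex_intro _ r erefl)).
Qed.

(** Strictly between [D] and its mirror line each step adds 2, so [weight] measures the progress of
    [r2] and, by transposition, [weight2] that of [r1]. *)
Lemma slide_weight n k (p : 'I_k -> node n) (D : 'I_n) r1 r2 (a b : 'I_n) :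
  mirror_start p D r1 r2 ->
  (p r1).2 <= a -> (p r1).2 <= b -> a < D -> b < D ->
  (weight D (slide p D r1 r2 a b) = weight D p + ((b - (p r1).2) + (b - (p r1).2))%N%:Z /\
   weight2 D (slide p D r1 r2 a b) = weight D p + ((a - (p r1).2) + (a - (p r1).2))%N%:Z)%R.
Proof.
move=> ms ya yb aD bD; have nr := mirror_neq ms.
have [[en hD inj] sym _ [e1 e2 lt lt'] _] := ms.
have w1 (a' b' : 'I_n) : (p r1).2 <= b' -> b' < D -> (weight D (slide p D r1 r2 a' b') =
    weight D p + ((b' - (p r1).2) + (b' - (p r1).2))%N%:Z)%R.
  move=> yb' bD'; rewrite /weight (bigD1 r2) //= [in RHS](bigD1 r2) //= slide_r2 // e2 /=.
  rewrite (eq_bigr (fun r => omega D (k * n).+1 (p r).1)).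
    have om (c : 'I_n) : rev_ord D < c -> c < D ->
        (omega D (k * n).+1 c = c%:Z + c%:Z + 1 - n%:Z)%R.
      move=> h1 h2; rewrite /omega; case: eqP => [E|_]; first by rewrite E ltnn in h2.
      by case: eqP => [E|_]; [rewrite E ltnn in h1|rewrite addr0 subr0].
    rewrite !om //; last by apply: leq_trans yb'.
    move: (\sum_(_ | _) _)%R yb' => s; move: (nat_of_ord b') (nat_of_ord (p r1).2) => u v.
    by clear; lia.
  move=> r nr2; have [->|m1] := eqVneq r r1; first by rewrite slide_r1 e1.
  by rewrite slide_other.
split; first exact: w1.
have := slide_swap ms yb ya bD aD => /esym.
move=> /(@weight_iso _ _ D _ _ true false false (slide_inj ms ya yb aD bD)) /= [<- _].
exact: w1.
Qed.

(** Only [r1] has slid. Alternating the assumed reflection with the diagonal symmetry of [p] carries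
    [(D, a)] around to a robot of [p] at [(D, a)], nearer to the corner than [r1] was. *)
Lemma slide_flip n k (p : 'I_k -> node n) (D : 'I_n) r1 r2 (a : 'I_n) : mirror_start p D r1 r2 ->
  (p r1).2 <= a -> a < D ->
  (fun v => config (slide p D r1 r2 a (p r1).2) (act false true false v)) <>
  config (slide p D r1 r2 a (p r1).2).
Proof.
move=> ms ya aD E; have nr := mirror_neq ms.
have [[en hD inj] sym nsym [e1 e2 lt lt'] [mx _]] := ms.
have [Ea|na] := eqVneq a (p r1).2.
  apply: (nsym true false isT); move: E.
  suff -> : slide p D r1 r2 a (p r1).2 = p by [].
  apply: functional_extensionality => r; rewrite /slide Ea.
  by case: eqP => [->|_]; [rewrite -e1; case: (p r1)|case: eqP => [->|]].
set P := slide _ _ _ _ _ _ in E.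
pose O v := exists r, P r = v; pose o v := exists r, p r = v.
have tau x y : o (x, y) -> o (y, x) by move=> /sym.
have flipO x y : O (x, y) -> O (rev_ord x, y).
  move=> h; apply/config_neq0; rewrite -E /= /act /flip /= rev_ordK.
  exact/config_neq0.
have Oo x y : O (x, y) -> (x, y) <> (D, a) -> o (x, y).
  move=> [r <-]; rewrite /P /slide; case: eqP => [_ /(_ erefl) //|_].
  by case: eqP => [_|_] _; [rewrite -e2; exists r2|exists r].
have oO x y : o (x, y) -> (x, y) <> (D, (p r1).2) -> O (x, y).
  move=> [r <-] ne; exists r; rewrite /P /slide; case: eqP => [E1|_].
    by case: ne; rewrite E1 -e1; case: (p r1).
  by case: eqP => [->|].
have ltya : (p r1).2 < a by rewrite ltn_neqAle ya andbT eq_sym.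
have nDD : rev_ord D <> D by move=> h; have := lt'; rewrite h => /ltnW; rewrite leqNgt lt.
have naD : a <> D by move=> h; rewrite h ltnn in aD.
have naD' : a <> rev_ord D by move=> h; have := ltn_trans lt' ltya; rewrite -h ltnn.
have nyD : (p r1).2 <> D by move=> h; rewrite h ltnn in lt.
have naa : rev_ord a <> a.
  by move=> /(congr1 (@nat_of_ord n)) /=; have := ltn_ord a; move: en; clear; lia.
have s0 : O (D, a) by exists r1; rewrite /P slide_r1.
have s1 : o (rev_ord D, a) by apply: Oo (flipO _ _ s0) _ => -[].
have s2 : O (rev_ord a, rev_ord D).
  by apply: flipO; apply: oO (tau _ _ s1) _ => -[].
have s3 : o (rev_ord D, rev_ord a).
  by apply: tau; apply: Oo s2 _ => -[_ /esym].
have s4 : O (D, rev_ord a).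
  by rewrite -(rev_ordK D); apply: flipO; apply: oO s3 _ => -[].
have s5 : O (a, D).
  rewrite -{1}(rev_ordK a); apply: flipO; apply: oO; last by case=> _ /esym.
  by apply: tau; apply: Oo s4 _ => -[].
have [r pr] : o (D, a) by apply: tau; apply: Oo s5 _ => -[].
by have := mx r; rewrite pr /= => /(_ erefl); rewrite leqNgt ltya.
Qed.

Ltac lia_ord := clear; repeat match goal with
  | |- context [nat_of_ord ?i] => move: (nat_of_ord i) => ? end; lia.

(** Both weights of an entry are nonnegative and a reflection reverses a sign, so the weight is 0
    and [b] is still at its initial value. What remains is a symmetry of [p] or the case of
    [slide_flip]. *)
Lemma slide_iso_fx n k (p : 'I_k -> node n) (D : 'I_n) r1 r2 (a b a' b' : 'I_n) sw fx fy :
  mirror_start p D r1 r2 -> (p r1).2 <= a < D -> (p r1).2 <= b < D ->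
  (p r1).2 <= a' < D -> (p r1).2 <= b' < D ->
  (fun v => config (slide p D r1 r2 a b) (act sw fx fy v)) = config (slide p D r1 r2 a' b') ->
  fx -> False.
Proof.
move=> ms /andP[ya aD] /andP[yb bD] /andP[ya' aD'] /andP[yb' bD'] E.
have [Wx Wy] := weight_iso D (slide_inj ms ya' yb' aD' bD') E.
have [x1 y1] := slide_weight ms ya yb aD bD.
have [x2 y2] := slide_weight ms ya' yb' aD' bD'.
have W0 : (0 <= weight D p)%R by case: ms => _ _ _ _ [_ []].
rewrite x1 x2 y2 in Wx; rewrite y1 x2 y2 in Wy.
case: fx E Wx => // E Wx _.
have Eb : b = (p r1).2.
  apply: ord_inj; move: Wx W0 ya yb ya' yb'.
  by clear; case: sw => /=; move: (weight D p) => w; lia_ord.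
subst b; case: fy E Wy => E Wy.
  have Ea : a = (p r1).2.
    apply: ord_inj; move: Wy W0 ya yb ya' yb'.
    by clear; case: sw => /=; move: (weight D p) => w; lia_ord.
  have Ea' : a' = (p r1).2.
    apply: ord_inj; move: Wx Wy W0 ya yb ya' yb'.
    by clear; case: sw => /=; move: (weight D p) => w; lia_ord.
  have Eb' : b' = (p r1).2.
    apply: ord_inj; move: Wx Wy W0 ya yb ya' yb'.
    by clear; case: sw => /=; move: (weight D p) => w; lia_ord.
  subst a a' b'; have [_ _ nsym [e1 e2 _ _] _] := ms.
  have pE : slide p D r1 r2 (p r1).2 (p r1).2 = p.
    apply: functional_extensionality => r; rewrite /slide.
    by case: eqP => [->|_]; [rewrite -e1; case: (p r1)|case: eqP => [->|]].
  have S := slide_swap ms ya ya aD aD; rewrite pE in E S.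
  apply: (nsym true true isT); case: sw E {Wx Wy} => E //.
  rewrite -{2}E S; apply: functional_extensionality => v.
  by have := congr1 (@^~ (act true true true v)) S; rewrite /= => <-.
case: sw E Wx Wy => /= E Wx Wy.
  have [Ea' Eb'] : a' = (p r1).2 /\ b' = a.
    split; apply: ord_inj; move: Wx Wy W0 ya yb ya' yb';
      move: (weight D p) => w; lia_ord.
  subst a' b'; apply: (slide_flip ms ya aD).
  have S := slide_swap ms ya yb aD bD.
  rewrite S in E; apply: functional_extensionality => v.
  have := congr1 (@^~ (act true false false v)) E; rewrite /=.
  have -> : act true false false (act true false false v) = v by exact: (@actK n true false false).
  by case: v.
have [Eb' Ea'] : b' = (p r1).2 /\ a' = a.
  split; apply: ord_inj; move: Wx Wy W0 ya yb ya' yb';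
    move: (weight D p) => w; lia_ord.
by subst a' b'; apply: (slide_flip ms ya aD).
Qed.

Lemma slide_iso n k (p : 'I_k -> node n) (D : 'I_n) r1 r2 (a b a' b' : 'I_n) sw fx fy :
  mirror_start p D r1 r2 -> (p r1).2 <= a < D -> (p r1).2 <= b < D ->
  (p r1).2 <= a' < D -> (p r1).2 <= b' < D ->
  (fun v => config (slide p D r1 r2 a b) (act sw fx fy v)) = config (slide p D r1 r2 a' b') ->
  [/\ fx = false, fy = false & (a', b') = if sw then (b, a) else (a, b)].
Proof.
move=> ms ha hb ha' hb' E.
have nfx : fx = false.
  by apply/negP => h; apply: (slide_iso_fx ms ha hb ha' hb' E).
have nfy : fy = false.
  apply/negP => h; move: ha hb ha' hb' => /andP[ya aD] /andP[yb bD] ha' hb'.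
  have S := slide_swap ms yb ya bD aD.
  apply: (@slide_iso_fx n k p D r1 r2 b a a' b' (~~ sw) fy fx) => //; rewrite ?ya ?yb //.
  rewrite -E S; apply: functional_extensionality => v; congr (config _ _).
  by rewrite /act; case: (sw).
split=> //; move: ha hb ha' hb' E => /andP[ya aD] /andP[yb bD] /andP[ya' aD'] /andP[yb' bD'].
rewrite nfx nfy => E.
have [Wx Wy] := weight_iso D (slide_inj ms ya' yb' aD' bD') E.
have [x1 y1] := slide_weight ms ya yb aD bD.
have [x2 y2] := slide_weight ms ya' yb' aD' bD'.
rewrite x1 x2 y2 in Wx; rewrite y1 x2 y2 in Wy.
by case: sw Wx Wy {E nfx nfy} => /= Wx Wy; congr pair; apply: ord_inj;
  move: Wx Wy ya yb ya' yb'; move: (weight D p) => w; lia_ord.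
Qed.

Lemma rank_corner n (D : 'I_n) (v : node n) : q v.1 <= q D -> q v.2 <= q D ->
  ~ (q v.1 = q D /\ q v.2 = q D) -> rank v < rank ((D, D) : node n).
Proof.
rewrite rank_lt /=; move: (q v.1) (q v.2) (q D) => x y z; lia.
Qed.

(** The default [a] at the border of the grid does not occur for [a] below [D], where the function
    is used. *)
Definition next_ord n (a : 'I_n) : 'I_n := insubd a a.+1.

Lemma next_ordE n (a : 'I_n) : a.+1 < n -> next_ord a = a.+1 :> nat.
Proof. by move=> h; rewrite /next_ord val_insubd h. Qed.

(** The table holds all positions of the two runners short of the corner. They run independently,
    and the first at [(D, D)] makes the goal quadrant dominant; the rank of this node is the
    threshold. *)
Lemma gatherable_mirror n k (p : 'I_k -> node n) (D : 'I_n) r1 r2 :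
  1 < n -> 1 < k -> mirror_start p D r1 r2 -> gatherable_1crash p.
Proof.
move=> n1 k1 ms; have nr := mirror_neq ms.
have nr' : r1 != r2 by rewrite eq_sym.
have [[en hD inj] sym nsym [e1 e2 lt lt'] [mx [qle qne W0]]] := ms.
set y := (p r1).2 in e2 lt lt' mx.
pose V (ab : 'I_n * 'I_n) := (y <= ab.1 < D) && (y <= ab.2 < D).
pose P (ab : 'I_n * 'I_n) := slide p D r1 r2 ab.1 ab.2.
pose M (ab : 'I_n * 'I_n) := slide p D r1 r2 (next_ord ab.1) (next_ord ab.2).
have nextE (a : 'I_n) : a < D -> next_ord a = a.+1 :> nat.
  by move=> aD; apply: next_ordE; apply: leq_ltn_trans (ltn_ord D).
have sgD : sg D by [].
have stp (ab : 'I_n * 'I_n) : V ab -> step (P ab r1) (M ab r1) /\ step (P ab r2) (M ab r2).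
  move=> /andP[/andP[_ h1] /andP[_ h2]]; rewrite /P /M !slide_r1 !slide_r2 //.
  rewrite /step /QT /= !nextE // sgD !eqxx /= !andbT.
  by case: (sg ab.1); case: (sg ab.2); rewrite ?orbT.
have Mo ab r : r != r1 -> r != r2 -> M ab r = P ab r.
  by move=> h1 h2; rewrite /M /P !slide_other.
have pE : p = P (y, y).
  apply: functional_extensionality => r; rewrite /P /slide /=.
  by case: eqP => [->|_]; [rewrite -e1 /y; case: (p r1)|case: eqP => [->|]].
have qlt (c : 'I_n) : y <= c < D -> q c < q D.
  move=> /andP[h1 h2]; have h3 := leq_trans lt' h1; move: h3 h2 (hD) en; rewrite /q /= hD.
  move: (ltn_ord D); move: (nat_of_ord D) (nat_of_ord c) => u w.
  by clear; case: ifP => h; lia.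
have rk ab r : V ab -> rank (P ab r) < rank ((D, D) : node n).
  move=> /andP[/qlt q1 /qlt q2]; rewrite /P /slide.
  case: ifP => _; first by apply: rank_corner => //=;
    [exact: ltnW|case=> _ h; rewrite h ltnn in q1].
  case: ifP => _; first by apply: rank_corner => //=; [exact: ltnW|case=> h; rewrite h ltnn in q2].
  by have [] := qle r; move=> *; apply: rank_corner.
have occrk ab h v : V ab -> is_aut h -> config (P ab) (h v) != 0 ->
    rank ((D, D) : node n) <= rank v -> False.
  move=> Vab hA /config_neq0[r E]; rewrite -(rank_aut v en n1 hA) -E leqNgt.
  by rewrite rk.
have dom (f : 'I_k -> node n) r ab : V ab -> f r = (D, D) ->
    (forall r', r' != r -> f r' = P ab r') -> dominant (rank ((D, D) : node n)) (config f).
  move=> Vab fr fo; exists (D, D); split=> //.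
  - by apply/config_neq0; exists r.
  - by rewrite /QT /= sgD.
  move=> v /config_neq0[r' <-]; have [->|/fo->] := eqVneq r' r; last by move=> _; apply: rk.
  by rewrite fr /QT /= sgD.
have next_lt (a : 'I_n) : y <= a < D -> (y <= next_ord a < D) \/ next_ord a = D.
  move=> /andP[h1 h2]; case: (ltngtP (next_ord a) D) => [h|h|/ord_inj]; [left| |by right].
    by rewrite nextE // leqW.
  by move: h; rewrite nextE // ltnS leqNgt h2.
apply: (@gatherable_of_table n k p (rank ((D, D) : node n)) _ (fun ab => V ab) P M) => //.
- move=> ab r /stp[s1 s2]; have [->|m1] := eqVneq r r1; first by right.
  by have [->|m2] := eqVneq r r2; [right|left; apply: Mo].
(* Isomorphic entries differ at most by the transposition, which exchanges the two runners. *)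
- move=> [a b] [a' b'] h r r' /andP[ha hb] /andP[ha' hb'] hA E.
  have [sw [fx [fy hE]]] := is_aut_classify n1 hA.
  have E' : (fun x => config (P (a, b)) (act sw fx fy x)) = config (P (a', b')).
    by rewrite -E; apply: functional_extensionality => x; rewrite hE.
  have [fx0 fy0] := slide_iso ms ha hb ha' hb' E'; rewrite !hE fx0 fy0.
  have Pinj : injective (P (a, b)).
    by move: ha hb => /andP[? ?] /andP[? ?]; apply: slide_inj.
  case: (sw) => -[-> ->] {E E' hE}; last first.
    have actI (v : node n) : act false false false v = v by case: v.
    by rewrite !actI => /Pinj->.
  have [->|m1] := eqVneq r' r1.
    rewrite [P (b, a) r1]slide_r1 [M (b, a) r1]slide_r1 /act /= => E.
    have -> : r = r2 by apply: Pinj; rewrite -E /P slide_r2.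
    by rewrite /M slide_r2.
  have [->|m2] := eqVneq r' r2.
    rewrite [P (b, a) r2]slide_r2 // [M (b, a) r2]slide_r2 // /act /= => E.
    have -> : r = r1 by apply: Pinj; rewrite -E /P slide_r1.
    by rewrite /M slide_r1.
  rewrite Mo // => E; rewrite E; have [Er|n1'] := eqVneq r r1.
    case/eqP: m2; apply: (@slide_inj _ _ p D r1 r2 b a ms).
    - by case/andP: hb.
    - by case/andP: ha.
    - by case/andP: hb.
    - by case/andP: ha.
    move: E; rewrite Er /P slide_r1 slide_r2 // /act /=.
    by case: (slide _ _ _ _ _ _ r') => u w /= [-> ->].
  have [Er|n2'] := eqVneq r r2; last by rewrite Mo.
  case/eqP: m1; apply: (@slide_inj _ _ p D r1 r2 b a ms).
  - by case/andP: hb.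
  - by case/andP: ha.
  - by case/andP: hb.
  - by case/andP: ha.
  move: E; rewrite Er /P slide_r1 slide_r2 // /act /=.
  by case: (slide _ _ _ _ _ _ r') => u w /= [-> ->].
- by move=> ab h Vab hA [v0 [o0 _ h0 _]]; apply: (occrk ab h v0).
- by move=> ab h v1 v2 v3 Vab hA _ [[_ o2 _] _ [_ _ h2 _] _]; apply: (occrk ab h v2).
- move=> [a b] r Vab; have /andP[ha hb] := Vab.
  have [->|m1] := eqVneq r r1.
    move=> _; have [h|h] := next_lt a ha.
      constructor 2; exists (next_ord a, b).
        split; first by rewrite /V h hb.
        apply: functional_extensionality => r'; rewrite /upd /P /M /slide /=.
        by rewrite eqxx; case: (r' == r1).
      by move=> r' /negPf nr1; right; rewrite /M /slide nr1.
    constructor 1; apply: (dom _ r1 (a, b)) => //.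
      by rewrite /upd eqxx /M slide_r1 h.
    by move=> r' /negPf nr1; rewrite /upd nr1.
  have [->|m2] := eqVneq r r2; last by rewrite Mo.
  move=> _; have [h|h] := next_lt b hb.
    constructor 2; exists (a, next_ord b).
      split; first by rewrite /V h ha.
      apply: functional_extensionality => r'; rewrite /upd /P /M /slide /=.
      by have [E|_] := eqVneq r' r2; rewrite ?E ?eqxx ?(negPf nr).
    by move=> r' /negPf nr2; right; rewrite /M /slide nr2.
  constructor 1; apply: (dom _ r2 (a, b)) => //.
    by rewrite /upd eqxx /M slide_r2 // h.
  by move=> r' /negPf nr2; rewrite /upd nr2.
- move=> ab r0 /stp[s1 s2]; have [->|n0] := eqVneq r0 r1.
    by exists r2 => //; apply: step_neq.
  by exists r1; rewrite 1?eq_sym //; apply: step_neq.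
by constructor 1; exists (y, y) => //; rewrite /V /= leqnn lt.
Qed.

(** For even [n] these involutions move every node across the centre, so all orbits have size 2. *)
Lemma flip_partitive n k (p : 'I_k -> node n) fx fy : ~~ odd n -> fx || fy ->
  (fun x => config p (act false fx fy x)) = config p -> partitive (config p).
Proof.
move=> en ff E; exists (act false fx fy), 2; split; first exact: is_aut_act.
split; first by move=> v; have := congr1 (@^~ v) E.
split=> // v; have sK : cancel (act false fx fy) (act false fx fy) := @actK n false fx fy.
have ne : act false fx fy v != v.
  apply/eqP => /(congr1 (fun v : node n => (sg v.1, sg v.2))).
  rewrite /act /= !sg_flip //; case: fx ff {E sK}; case: fy => //= _ [].
  - by case: (sg v.1).
  - by case: (sg v.1).
  - by case: (sg v.2).
apply: (@order_cycle _ (act false fx fy) [:: v; act false fx fy v]).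
- by rewrite /= sK !eqxx.
- by rewrite /= inE eq_sym ne.
- by rewrite inE eqxx.
Qed.

Lemma gatherable_symmetric n k (p : 'I_k -> node n) :
  ~~ odd n -> 1 < n -> 1 < k -> injective p ->
  (fun x => config p (act true false false x)) = config p ->
  (forall fx fy, fx || fy -> (fun x => config p (act false fx fy x)) <> config p) ->
  (exists d, [/\ forall r, q (p r).1 <= d /\ q (p r).2 <= d,
    exists r, q (p r).1 = d \/ q (p r).2 = d &
    forall r, ~ (q (p r).1 = d /\ q (p r).2 = d)]) ->
  gatherable_1crash p.
Proof.
move=> en n1 k1 inj symE nsym [d [dle [rd dr] dne]].
have sym (p' : 'I_k -> node n) v : (fun x => config p' (act true false false x)) = config p' ->
    (exists r : 'I_k, p' r = v) -> exists r, p' r = (v.2, v.1).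
  by move=> E h; apply/config_neq0; rewrite -E; apply/config_neq0; case: v h.
have dn : d < n./2 by case: dr => <-; apply: q_half.
have hD : n./2 + d < n by move: en dn; clear; lia.
pose D := Ordinal hD.
have qD : q D = d by rewrite /q /= leq_addr addKn.
(* The case where the corner in the goal quadrant has nonnegative weight. *)
have core (p' : 'I_k -> node n) : injective p' ->
    (fun x => config p' (act true false false x)) = config p' ->
    (forall fx fy, fx || fy -> (fun x => config p' (act false fx fy x)) <> config p') ->
    (forall r, q (p' r).1 <= d /\ q (p' r).2 <= d) ->
    (forall r, ~ (q (p' r).1 = d /\ q (p' r).2 = d)) ->
    (exists r, q (p' r).1 = d \/ q (p' r).2 = d) -> (0 <= weight D p')%R ->
    gatherable_1crash p'.
  move=> inj' symE' nsym' dle' dne' [rd' dr'] W0.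
  have qd (c : 'I_n) : q c = d -> c = D \/ c = rev_ord D.
    rewrite /q; have := ltn_ord c; case: ifP => h l e; [left|right]; apply: ord_inj => /=;
      move: h l e en dn; clear; move: (nat_of_ord c) => u; lia.
  (* Some robot is on the border of the enclosing square; diagonal symmetry makes this concern the
     first coordinate, and the sign of the weight selects the side [D]. *)
  have [rs rsD] : exists r, (p' r).1 = D.
    have [r0 hr0] : exists r, q (p' r).1 = d.
      case: dr' => [h|h]; first by exists rd'.
      have [r E] := sym p' _ symE' (ex_intro _ rd' erefl).
      by exists r; rewrite E.
    by case: (qd _ hr0) => [h|/(weight_side W0)]; [exists r0|].
  have [r1 r1D mx] : exists2 r1, (p' r1).1 = D & forall r, (p' r).1 = D -> (p' r).2 <= (p' r1).2.
    case: (@arg_maxnP _ rs (fun r => (p' r).1 == D) (fun r => (p' r).2 : nat)).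
      exact/eqP.
    by move=> r /eqP h mx; exists r => // r' /eqP; apply: mx.
  have [r2 E2] := sym p' _ symE' (ex_intro _ r1 erefl).
  have [q1 q2] := dle' r1.
  have nq : q (p' r1).2 <> d by move=> h; apply: (dne' r1); rewrite r1D qD h.
  have [lt lt'] : (p' r1).2 < D /\ rev_ord D < (p' r1).2.
    move: q2 nq en dn; rewrite /q /=; move: (ltn_ord (p' r1).2).
    move: (nat_of_ord (p' r1).2) => u; clear.
    by case: ifP => h *; split; lia.
  apply: (@gatherable_mirror n k p' D r1 r2 n1 k1); split.
  - by split=> //=; apply: leq_addr.
  - by move=> v; apply: sym.
  - by [].
  - by split=> //; rewrite E2 r1D.
  - by split=> //; split=> //; rewrite qD.
have [W0|W0] := boolP (0 <= weight D p)%R; first by apply: core => //; exists rd.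
(* The half-turn commutes with all symmetries, exchanges the two corners on the axis and changes the
   sign of the weight. *)
set s := @act n false true true.
have sK : cancel s s := @actK n false true true.
have sA : is_aut s := @is_aut_act n false true true.
have cE : config (fun r => s (p r)) = fun v => config p (s v) by apply: config_aut.
have comm sw fx fy v : s (act sw fx fy v) = act sw fx fy (s v).
  by case: sw; rewrite /s /act /= /flip; case: fx; case: fy; rewrite ?rev_ordK.
have qs r : q (s (p r)).1 = q (p r).1 /\ q (s (p r)).2 = q (p r).2.
  by rewrite /s /act /= !(@q_flip n true).
apply: (@gatherable_reframe _ _ s) => //; apply: core.
- by move=> r r' /(can_inj sK)/inj.
- rewrite cE; apply: functional_extensionality => v; rewrite comm.
  exact: (congr1 (@^~ (s v)) symE).
- move=> fx fy ff; rewrite cE => E; apply: (nsym fx fy ff).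
  apply: functional_extensionality => v; have := congr1 (@^~ (s v)) E.
  by rewrite /= comm sK.
- by move=> r; have [-> ->] := qs r.
- by move=> r; have [-> ->] := qs r.
- by exists rd; have [-> ->] := qs rd.
have : (fun x => config p (act false true true x)) = config (fun r => s (p r)) by rewrite cE.
have inj' : injective (fun r => s (p r)) by move=> r r' /(can_inj sK)/inj.
move=> /(@weight_iso _ _ D _ _ false true true inj') /= [E _].
move: W0; rewrite E; move: (weight _ _) => w; clear; lia.
Qed.

(** * Reduction of an arbitrary start to the two types *)

Lemma enclosing_act n k (p : 'I_k -> node n) fx fy d : ~~ odd n ->
  [/\ forall r, q (p r).1 <= d /\ q (p r).2 <= d,
    exists r, q (p r).1 = d \/ q (p r).2 = d &
    forall r, ~ (q (p r).1 = d /\ q (p r).2 = d)] ->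
  let p' r := act false fx fy (p r) in
  [/\ forall r, q (p' r).1 <= d /\ q (p' r).2 <= d,
    exists r, q (p' r).1 = d \/ q (p' r).2 = d &
    forall r, ~ (q (p' r).1 = d /\ q (p' r).2 = d)].
Proof.
move=> en [h1 [r h2] h3] p'.
have E r' : q (p' r').1 = q (p r').1 /\ q (p' r').2 = q (p r').2.
  by rewrite /p' /act /= !q_flip.
split; [move=> r'|exists r|move=> r'].
- by have [-> ->] := E r'.
- by have [-> ->] := E r.
- by have [-> ->] := E r'.
Qed.

Theorem theorem7 (n k : nat) (pos0 : 'I_k -> node n) :
  ~~ odd n -> 3 <= k -> injective pos0 ->
  ~ partitive (config pos0) ->
  mes_corners_empty (config pos0) ->
  gatherable_1crash pos0.
Proof.
move=> en k3 inj npart mc.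
have k1 : 1 < k by apply: leq_trans k3.
have k0 : 0 < k by apply: leq_trans k3.
have n1 : 1 < n by have := ltn_ord (pos0 (Ordinal k0)).1; move: en; clear; lia.
have [d hd] := enclosing_square en k0 mc.
have nsym fx fy : fx || fy -> (fun x => config pos0 (act false fx fy x)) <> config pos0.
  by move=> ff /(flip_partitive en ff).
have compE (h h' : node n -> node n) : (fun x => config pos0 (h x)) = config pos0 ->
    (fun x => config pos0 (h' x)) = config pos0 -> (fun x => config pos0 (h (h' x))) = config pos0.
  move=> E E'; rewrite -[RHS]E'; apply: functional_extensionality => v.
  exact: (congr1 (@^~ (h' v)) E).
(* Reflections and the half-turn would make the start partitive, so any other nontrivial symmetry
   involves a transposition. *)
case: (classic (exists fx fy, (fun x => config pos0 (act true fx fy x)) = config pos0)); last first.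
  move=> noref; apply: gatherable_asymmetric => //.
    move=> h hA E; have [sw [fx [fy hE]]] := is_aut_classify n1 hA.
    have E' : (fun x => config pos0 (act sw fx fy x)) = config pos0.
      by rewrite -[RHS]E; apply: functional_extensionality => v; rewrite hE.
    case: sw hE E' => hE E'; first by case: noref; exists fx, fy.
    have [ff|] := boolP (fx || fy); first by case: (nsym fx fy ff).
    by rewrite negb_or => /andP[/negPf fx0 /negPf fy0] v; rewrite hE fx0 fy0; case: v.
  (* An outermost robot touches the border of the enclosing square, so on a diagonal it would occupy
     a corner. *)
  move=> r tr; apply/eqP => e; have [h1 [rd h2] h3] := hd.
  apply: (h3 r); have tr' := tr rd; rewrite leqNgt rank_lt e in tr'; rewrite e.
  have := h1 r; have := h1 rd; move: h2 tr'; rewrite e.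
  move: (q (pos0 r).2) (q (pos0 rd).1) (q (pos0 rd).2); clear; lia.
move=> [fx [fy E]]; case: fx E; case: fy => E.
(* The antidiagonal symmetry becomes the diagonal one after reflecting one coordinate. *)
- apply: (@gatherable_reframe _ _ (act false true false)); first exact: is_aut_act.
  set p' := fun r => _.
  have sK : cancel (@act n false true false) (act false true false) := @actK n false true false.
  have cE : config p' = fun v => config pos0 (act false true false v) by apply: config_aut.
  apply: gatherable_symmetric => //.
  + by move=> r r' /(can_inj sK)/inj.
  + rewrite cE; apply: functional_extensionality => v.
    have := congr1 (@^~ (act false true false v)) E; rewrite /= => <-.
    by congr (config _ _); rewrite /act /flip /= rev_ordK.
  + move=> fx fy ff; rewrite cE => E'; apply: (nsym fx fy ff).
    apply: functional_extensionality => v; have := congr1 (@^~ (act false true false v)) E'.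
    rewrite /= sK => <-; congr (config _ _).
    by rewrite /act /flip /=; case: fx {ff E'}; case: fy; rewrite ?rev_ordK.
  + by exists d; apply: enclosing_act.
(* The square of a quarter-turn is the half-turn, already excluded. *)
- case: (nsym true true isT); rewrite -[RHS](compE _ _ E E).
  by apply: functional_extensionality => v; congr (config _ _); rewrite /act /flip /=.
- case: (nsym true true isT); rewrite -[RHS](compE _ _ E E).
  by apply: functional_extensionality => v; congr (config _ _); rewrite /act /flip /=.
- by apply: gatherable_symmetric => //; exists d.
Qed.
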